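(* (Algebraic Nullstellensatz) Let $\mathfrak{a}\subset\tilde{\mathbb{T}}[x_1,\dots,x_n]$ be a finitely generated tropical ideal of the reduced polynomial semiring with $\tilde{\mathbb{U}}[x_1,\dots,x_n]\subseteq\mathfrak{a}$. Then $$\sqrt{\mathfrak{a}}=I_{\mathrm{tr}}\bigl(C_{\mathrm{tr}}(\mathfrak{a})\bigr).$$
   Context: Extended tropical semiring: $\mathbb{T}=\mathbb{R}\cup\{-\infty\}\cup\mathbb{R}^\nu$, where $\mathbb{R}^\nu=\{a^\nu : a\in\mathbb{R}\}$ is a disjoint copy of $\mathbb{R}$. Elements of $\mathbb{R}$ are tangible, elements of $\mathbb{U}=\mathbb{R}^\nu$ are ghost; $\bar{\mathbb{R}}=\mathbb{R}\cup\{-\infty\}$, $\bar{\mathbb{U}}=\mathbb{U}\cup\{-\infty\}$. Put $(a^\nu)^\nu=a^\nu$ and $(-\infty)^\nu=-\infty$. Total order: $-\infty$ is the least element; for reals $a<b$ each of $a,a^\nu$ is $\prec$ each of $b,b^\nu$; and $a\prec a^\nu$. Addition: $\alpha\oplus\beta=\max_{\prec}\{\alpha,\beta\}$ if $\alpha\ne\beta$, and $\alpha\oplus\alpha=\alpha^\nu$. Multiplication: $a\odot b=a+b$, $a^\nu\odot b=a\odot b^\nu=a^\nu\odot b^\nu=(a+b)^\nu$ for $a,b\in\mathbb{R}$, and $-\infty$ is absorbing. This is a commutative semiring with zero $-\infty$ and unit $0$. $\pi:\mathbb{T}\to\bar{\mathbb{R}}$ is $\pi(a)=\pi(a^\nu)=a$,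 $\pi(-\infty)=-\infty$. $\mathbb{T}[x_1,\dots,x_n]$ is the semiring of formal polynomials over $\mathbb{T}$, $f(\mathbf{a})$ denotes evaluation at $\mathbf{a}\in\mathbb{T}^{(n)}$ ($n$-fold product), and a monomial of $f$ is a term with coefficient $\ne-\infty$. Reduced semiring. A monomial $h$ of $f$ is inessential if the polynomial $f\setminus h$ (all other monomials of $f$, assumed nonempty) dominates $h$, i.e. $(f\setminus h)(\mathbf{a})\oplus h(\mathbf{a})=(f\setminus h)(\mathbf{a})$ for all $\mathbf{a}\in\mathbb{T}^{(n)}$; otherwise $h$ is essential. The essential part $f^{\mathrm e}$ is the sum of the essential monomials. For $f=\bigoplus\alpha_{\mathbf{i}}\mathbf{x}^{\mathbf{i}}$, let $\overline{\mathcal{CH}}_f$ (the essential complex) be the upper part, with respect to the last coordinate, of the convex hull in $\mathbb{R}^{n+1}$ of the points $(\mathbf{i},\pi(\alpha_{\mathbf{i}}))$, $\alpha_{\mathbf{i}}\ne-\infty$; its lattice points are its points whose first $n$ coordinates lie in $\mathbb{N}^n$. The vertices of $\overline{\mathcal{CH}}_f$ correspond to the essential monomials. The full closure $\tilde f$ is $f^{\mathrm e}$ plus the ghost monomials $\beta^\nu\mathbf{x}^{\mathbf{j}}$ for all lattice points $(\mathbf{j},\beta)$ of $\overline{\mathcal{CH}}_f$ that are not vertices; $f$ is full if $f=\tilde f$. Polynomials defining the same function $\mathbb{T}^{(n)}\to\mathbb{T}$ have the same full closure. $\tilde{\mathbb{T}}[x_1,\dots,x_n]$ is the set of full polynomials,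 with sum and product being the full closures of the sum and product in $\mathbb{T}[x_1,\dots,x_n]$ (it is identified with the semiring of polynomial functions). $\tilde{\mathbb{U}}[x_1,\dots,x_n]$ is the set of full polynomials all of whose coefficients are ghost. Ideals. A tropical ideal $\mathfrak{a}$ of $\tilde{\mathbb{T}}[x_1,\dots,x_n]$ contains $-\infty$, is closed under $\oplus$ and under multiplication by arbitrary elements of $\tilde{\mathbb{T}}[x_1,\dots,x_n]$; it is finitely generated if it consists of all $\bigoplus_{i=1}^s h_if_i$ for some fixed $f_1,\dots,f_s$. The radical is $\sqrt{\mathfrak{a}}=\{f : f^k\in\mathfrak{a}\text{ for some positive }k\in\mathbb{N}\}$. Topology. $\bar{\mathbb{U}}$ has the Euclidean topology of a half line $[0,\infty)$ with endpoint $-\infty$. A subset of $\mathbb{T}$ is closed if it has the form $U\cup V^\nu$ with $U\subseteq\bar{\mathbb{R}}$, $V^\nu\subseteq\bar{\mathbb{U}}$, where $U^\nu=\{u^\nu:u\in U\}$ and $V^\nu$ are closed in $\bar{\mathbb{U}}$ and $U^\nu\subseteq V^\nu$. $\mathbb{T}^{(n)}$ has the product topology. Com-sets. $Z_{\mathrm{tr}}(f)=\{\mathbf{a}\in\mathbb{T}^{(n)}: f(\mathbf{a})\in\bar{\mathbb{U}}\}$, and $C_{\mathrm{tr}}(f)$ is the set of connected components of $\mathbb{T}^{(n)}\setminus Z_{\mathrm{tr}}(f)$ (by convention $\{\emptyset\}$ if this complement is empty). $C_{\mathrm{tr}}(\mathfrak{a})=\bigcup_{f\in\mathfrak{a}}C_{\mathrm{tr}}(f)$.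 For a collection $C$ of subsets of $\mathbb{T}^{(n)}$, $I_{\mathrm{tr}}(C)$ is the set of $f\in\tilde{\mathbb{T}}[x_1,\dots,x_n]$ such that every $D_f\in C_{\mathrm{tr}}(f)$ is contained in some $D\in C$. *)

(* Defs.v *)
From HB Require Import structures.
From mathcomp Require Import all_boot all_order all_algebra finmap.
From mathcomp Require Import all_classical all_reals all_analysis.
From mathcomp Require Import lra.

Set Implicit Arguments.
Unset Strict Implicit.
Unset Printing Implicit Defensive.

Import Order.TTheory GRing.Theory Num.Theory.
Import numFieldNormedType.Exports.

Local Open Scope classical_set_scope.
Local Open Scope ring_scope.

Inductive trop (R : realType) : Type :=
  | NegInf : trop R          (* -oo *)
  | Tan of R                 (* a, tangible *)
  | Gho of R.                (* a^nu, ghost *)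

Arguments NegInf {R}.

Section TropSemiring.
Context {R : realType}.
Implicit Types x y z : trop R.

Definition trop_code x : option (R * bool) :=
  match x with
  | NegInf => None
  | Tan a => Some (a, false)
  | Gho a => Some (a, true)
  end.

Definition trop_decode (c : option (R * bool)) : trop R :=
  match c with
  | None => NegInf
  | Some (a, g) => if g then Gho a else Tan a
  end.

Lemma trop_codeK : cancel trop_code trop_decode.
Proof. by case. Qed.

HB.instance Definition _ := Choice.copy (trop R) (can_type trop_codeK).

Definition nu x : trop R := if x is Tan a then Gho a else x.

(* The strict total order, with [a] immediately below [a^nu]. *)
Definition trop_lt x y : bool :=
  match x, y with
  | _, NegInf => false
  | NegInf, _ => true
  | Tan a, Gho b => a <= b
  | Tan a, Tan b | Gho a, Tan b | Gho a, Gho b => a < b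
  end.

Definition trop_add x y : trop R :=
  if x == y then nu x else if trop_lt x y then y else x.

Definition trop_mul x y : trop R :=
  match x, y with
  | NegInf, _ | _, NegInf => NegInf
  | Tan a, Tan b => Tan (a + b)
  | Tan a, Gho b | Gho a, Tan b | Gho a, Gho b => Gho (a + b)
  end.

Lemma trop_eqE x y :
  (x == y) = match x, y with
             | NegInf, NegInf => true
             | Tan a, Tan b | Gho a, Gho b => a == b
             | _, _ => false
             end.
Proof.
rewrite -(inj_eq (can_inj trop_codeK)).
by case: x y => [|a|a] [|b|b] //=; rewrite /eq_op /= /eq_op /= ?andbT ?andbF.
Qed.

Lemma trop_addE x y : trop_add x y =
  match x, y with
  | NegInf, _ => y
  | _, NegInf => x
  | Tan a, Tan b => if a == b then Gho a else if a < b then y else x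
  | Tan a, Gho b => if a <= b then y else x
  | Gho a, Tan b | Gho a, Gho b => if a < b then y else x
  end.
Proof.
rewrite /trop_add trop_eqE.
by case: x y => [|a|a] [|b|b] //=; case: eqP => // ->; rewrite ltxx.
Qed.

Lemma trop_addC : commutative trop_add.
Proof.
move=> x y; rewrite !trop_addE; case: x y => [|a|a] [|b|b] //=;
  by case: (ltgtP a b) => // ->.
Qed.

Lemma trop_add0 : left_id NegInf trop_add.
Proof. by move=> x; rewrite trop_addE. Qed.

Lemma trop_addA : associative trop_add.
Proof.
move=> x y z; rewrite !trop_addE; case: x y z => [|a|a] [|b|b] [|c|c] //=;
  repeat (match goal with
    | |- context [if ?u == ?v then _ else _] => case: (ltgtP u v) => ? //=
    | |- context [if ?u < ?v then _ else _] => case: (ltgtP u v) => ? //=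
    | |- context [if ?u <= ?v then _ else _] => case: (ltgtP u v) => ? //=
    end; subst => //=); try (exfalso; lra); congr (_ _); lra.
Qed.

Lemma trop_mulC : commutative trop_mul.
Proof. by move=> [|a|a] [|b|b] //=; rewrite addrC. Qed.

Lemma trop_mulA : associative trop_mul.
Proof. by move=> [|a|a] [|b|b] [|c|c] //=; rewrite addrA. Qed.

Lemma trop_mul1 : left_id (Tan 0) trop_mul.
Proof. by move=> [|a|a] //=; rewrite add0r. Qed.

Lemma trop_mul0 : left_zero NegInf trop_mul.
Proof. by []. Qed.

Lemma trop_mulDl : left_distributive trop_mul trop_add.
Proof.
move=> x y z; rewrite !trop_addE; case: x y z => [|a|a] [|b|b] [|c|c] //=;
  rewrite ?(inj_eq (addIr c)) ?ltrD2r ?lerD2r //;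
  by case: (ltgtP a b) => // ->.
Qed.

Lemma trop_1neq0 : Tan 0 != NegInf :> trop R.
Proof. by []. Qed.

HB.instance Definition _ :=
  GRing.isNmodule.Build (trop R) trop_addA trop_addC trop_add0.
HB.instance Definition _ := GRing.Nmodule_isComNzSemiRing.Build (trop R)
  trop_mulA trop_mulC trop_mul1 trop_mulDl trop_mul0 trop_1neq0.

(* The projection [pi], restricted to the elements other than -oo; its value at
   -oo is a dummy. *)
Definition trop_val x : R :=
  match x with NegInf => 0 | Tan a | Gho a => a end.

Definition Rbar : set (trop R) := [set x | x = NegInf \/ exists a, x = Tan a].
Definition Ubar : set (trop R) := [set x | x = NegInf \/ exists a, x = Gho a].

(* On [Ubar] this is a bijection onto [0, +oo[, sending the endpoint -oo to 0;
   it carries the topology of the half line. *)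
Definition half_line x : R :=
  match x with NegInf => 0 | Tan a | Gho a => expR a end.

Definition Ubar_closed (S : set (trop R)) : Prop :=
  S `<=` Ubar /\ closed (half_line @` S).

Definition trop_closed (A : set (trop R)) : Prop :=
  exists U V : set (trop R),
    [/\ U `<=` Rbar, Ubar_closed (nu @` U), Ubar_closed V, nu @` U `<=` V
      & A = U `|` V].

Definition trop_open (A : set (trop R)) : Prop := trop_closed (~` A).

Lemma nu_Rbar_Ubar (U : set (trop R)) : U `<=` Rbar -> nu @` U `<=` Ubar.
Proof.
move=> sU _ [x /sU [->|[a ->]] <-]; first by left.
by right; exists a.
Qed.

Lemma half_line_inj : {in Ubar &, injective half_line}.
Proof.
move=> x y; rewrite !inE => -[->|[a ->]] [->|[b ->]] //=.
- by move=> e; have := expR_gt0 b; rewrite -e ltxx.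
- by move=> e; have := expR_gt0 a; rewrite e ltxx.
- by move/expR_inj ->.
Qed.

Lemma nu_Rbar_inj : {in Rbar &, injective nu}.
Proof.
by move=> x y; rewrite !inE => -[->|[a ->]] [->|[b ->]] //= [->].
Qed.

(* A set is closed iff its traces on [Rbar] and [Ubar] witness it. *)
Lemma trop_closedP (A : set (trop R)) : trop_closed A <->
  [/\ Ubar_closed (nu @` (A `&` Rbar)), Ubar_closed (A `&` Ubar)
    & nu @` (A `&` Rbar) `<=` A].
Proof.
split=> [[U [V [UR [_ cU] [VU cV] UV ->]]]|[cR cU sA]]; last first.
  exists (A `&` Rbar), (A `&` Ubar); split => //.
    move=> x Ax; split; first exact: sA.
    by move: x Ax; apply: nu_Rbar_Ubar; exact: subIsetr.
  rewrite -setIUr; apply/seteqP; split=> [x Ax|x []//]; split => //.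
  by case: x Ax => [|a|a] _; [left; left|left; right; exists a|
                              right; right; exists a].
have tU : (U `|` V) `&` Ubar = V.
  apply/seteqP; split=> [x [[Ux|//] Ubx]|x Vx]; last by split; [right|exact: VU].
  apply: UV; exists x => //; case: Ubx => [->//|[a xE]].
  by case: (UR _ Ux) => [->//|[b]]; rewrite xE.
have sub : nu @` ((U `|` V) `&` Rbar) `<=` V.
  move=> _ [x [[Ux|Vx] Rx] <-]; first by apply: UV; exists x.
  case: Rx Vx => [->//|[a ->]] /VU [//|[b]//].
rewrite tU; split.
- split; first by apply: nu_Rbar_Ubar; exact: subIsetr.
  have [VN|VN] := pselect (V NegInf); last first.
    suff -> : (U `|` V) `&` Rbar = U by [].
    apply/seteqP; split=> [x [[//|Vx] Rx]|x Ux]; last by split; [left|exact: UR].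
    by case: Rx Vx => [->//|[a ->]] /VU [//|[b]//].
  suff -> : (U `|` V) `&` Rbar = U `|` [set NegInf].
    rewrite image_setU image_set1 image_setU image_set1.
    by apply: closedU cU _; exact: closed_eq.
  apply/seteqP; split=> [x [[Ux|Vx] Rx]|x [Ux|->]].
  + by left.
  + by case: Rx (VU _ Vx) => [->|[a ->]]; [right|move=> [|[b]]].
  + by split; [left|exact: UR].
  + by split; [right|left].
- by split.
- by move=> x /sub Vx; right.
Qed.

Lemma Ubar_closed_bigI (I : Type) (F : I -> set (trop R)) (i0 : I) :
  (forall i, Ubar_closed (F i)) -> Ubar_closed (\bigcap_i F i).
Proof.
move=> cF; split; first by move=> x /(_ i0 Logic.I); apply: (cF i0).1.
suff -> : half_line @` (\bigcap_i F i) = \bigcap_i (half_line @` F i).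
  by apply: closed_bigI => i _; exact: (cF i).2.
apply/seteqP; split=> [_ [x Fx <-] i _|y Fy]; first by exists x => //; exact: Fx.
have [x Fx xy] := Fy i0 Logic.I; exists x => // i _.
have [z Fz zy] := Fy i Logic.I; suff -> : x = z by [].
apply: half_line_inj; rewrite ?inE ?xy ?zy//.
- exact: (cF i0).1.
- exact: (cF i).1.
Qed.

Lemma Ubar_closedU (A B : set (trop R)) :
  Ubar_closed A -> Ubar_closed B -> Ubar_closed (A `|` B).
Proof.
move=> [sA cA] [sB cB]; split; first by rewrite subUset.
by rewrite image_setU; exact: closedU.
Qed.

Lemma trop_openT : trop_open setT.
Proof.
exists set0, set0; rewrite setCT setU0 !image_set0.
have c0 : Ubar_closed set0 by split=> //; rewrite image_set0; exact: closed0.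
by split.
Qed.

Lemma trop_openI : setI_closed trop_open.
Proof.
move=> A B [U [V [? ? ? ? AE]]] [U' [V' [? ? ? ? BE]]].
exists (U `|` U'), (V `|` V'); rewrite setCI AE BE image_setU setUACA; split=> //.
- by rewrite subUset.
- exact: Ubar_closedU.
- exact: Ubar_closedU.
- exact: setUSS.
Qed.

Lemma trop_open_bigU (I : Type) (F : I -> set (trop R)) :
  (forall i, trop_open (F i)) -> trop_open (\bigcup_i F i).
Proof.
move=> oF; have [[i0]|noI] := pselect (inhabited I); last first.
  suff -> : \bigcup_i F i = set0.
    apply/trop_closedP; rewrite setC0 !setTI.
    have cU : Ubar_closed Ubar.
      split=> //; suff -> : half_line @` Ubar = [set r | 0 <= r].
        exact: closed_ge.
      apply/seteqP; split=> [_ [x [->|[a ->]] <-]/=|r /=]; rewrite ?expR_ge0//.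
      rewrite le_eqVlt => /predU1P[<-|r0]; first by exists NegInf => //; left.
      by exists (Gho (ln r)); [right; exists (ln r)|rewrite /= lnK].
    suff -> : nu @` Rbar = Ubar by split.
    apply/seteqP; split; first exact: nu_Rbar_Ubar.
    move=> x [->|[a ->]]; first by exists NegInf => //; left.
    by exists (Tan a) => //; right; exists a.
  by apply/seteqP; split=> // x [i]; case: noI.
have {}oF i := (trop_closedP _).1 (oF i).
apply/trop_closedP; rewrite setC_bigcup -!bigcapIl; [|by exists i0..].
split.
- suff -> : nu @` (\bigcap_i (~` F i `&` Rbar)) =
            \bigcap_i (nu @` (~` F i `&` Rbar)).
    by apply: Ubar_closed_bigI => // i; have [] := oF i.
  apply/seteqP; split=> [_ [x Fx <-] i _|y Fy]; first by exists x => //; exact: Fx.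
  have [x [Fx Rx] xy] := Fy i0 Logic.I; exists x => // i _; split => //.
  have [z [Fz Rz] zy] := Fy i Logic.I; suff -> : x = z by [].
  by apply: nu_Rbar_inj; rewrite ?inE ?xy ?zy.
- by apply: Ubar_closed_bigI => // i; have [] := oF i.
- move=> _ [x Fx <-] i _; have [_ _] := oF i; apply.
  by exists x => //; exact: Fx.
Qed.

HB.instance Definition _ :=
  isOpenTopological.Build (trop R) trop_openT trop_openI trop_open_bigU.

End TropSemiring.

Definition expo (n : nat) : Type := {ffun 'I_n -> nat}.
HB.instance Definition _ n := Choice.on (expo n).
HB.instance Definition _ n := GRing.Nmodule.on (expo n).

(* A polynomial is the finitely supported family of its coefficients: its
   monomials are indexed by [finsupp f]. *)
Definition tpoly (R : realType) (n : nat) : Type :=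
  {fsfun expo n -> trop R with 0}.

Definition tpoint (R : realType) (n : nat) : Type := {ptws 'I_n -> trop R}.
HB.instance Definition _ R n := Topological.on (tpoint R n).

Section Polynomials.
Context {R : realType} {n : nat}.
Implicit Types (f g h : tpoly R n) (m : expo n) (a : tpoint R n).

Definition pmon m (c : trop R) : tpoly R n := [fsfun k in [fset m]%fset => c].
Definition pzero : tpoly R n := [fsfun].
Definition pone : tpoly R n := pmon 0 1.

Definition padd f g : tpoly R n :=
  [fsfun m in (finsupp f `|` finsupp g)%fset => (f m + g m)%R].

Definition pmul f g : tpoly R n :=
  [fsfun m in [fset (p + q)%R | p in finsupp f, q in finsupp g]%fset =>
    \sum_(p <- finsupp f) \sum_(q <- finsupp g | p + q == m) f p * g q].

Definition peval f a : trop R :=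
  \sum_(m <- finsupp f) f m * \prod_(i < n) a i ^+ m i.

Lemma pmonE m c k : pmon m c k = if k == m then c else 0 :> trop R.
Proof. by rewrite fsfunE inE. Qed.

Lemma pzeroE m : (pzero : tpoly R n) m = 0.
Proof. by rewrite fsfunE. Qed.

Lemma paddE f g m : padd f g m = f m + g m.
Proof.
rewrite fsfunE inE; case: (finsuppP f m) => //= _;
  case: (finsuppP g m) => //= _; rewrite addr0.
Qed.

Lemma pmulE f g m : pmul f g m =
  \sum_(p <- finsupp f) \sum_(q <- finsupp g | p + q == m) f p * g q.
Proof.
rewrite fsfunE; case: ifPn => // mS; rewrite big_seq big1 // => p pf.
rewrite big_seq_cond big1 // => q /andP[qg /eqP mE].
by case/negP: mS; rewrite -mE; apply/imfset2P; exists p => //; exists q.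
Qed.

Definition dominates g h : Prop := forall a, peval g a + peval h a = peval g a.

Definition pdrop f m : tpoly R n := [fsfun f without m].

Lemma pdropE f m k : pdrop f m k = if k == m then 0 else f k.
Proof. by rewrite /pdrop fsfun_withE. Qed.

(* For m in [finsupp f]; when it is the only monomial of [f] it is essential. *)
Definition inessential f m : Prop :=
  pdrop f m <> pzero /\ dominates (pdrop f m) (pmon m (f m)).

Definition essential f m : Prop := m \in finsupp f /\ ~ inessential f m.

Definition essential_part f : tpoly R n :=
  [fsfun m in [fset m in finsupp f | `[< essential f m >]]%fset => f m].

(* R^(n+1), with the last coordinate singled out *)
Definition space : Type := ('rV[R]_n * R^o)%type.
HB.instance Definition _ := GRing.Lmodule.on space.

Definition expv m : 'rV[R]_n := \row_(i < n) (m i)%:R.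

Definition convex_hull (S : {fset space}) : set space :=
  [set x | exists w : space -> R, [/\ forall p, 0 <= w p,
     \sum_(p <- S) w p = 1 & x = \sum_(p <- S) w p *: p]].

Definition newton_points f : {fset space} :=
  [fset ((expv m, trop_val (f m)) : space) | m in finsupp f]%fset.

Definition newton_hull f : set space := convex_hull (newton_points f).

Definition essential_complex f : set space :=
  [set x | newton_hull f x /\
     forall t : R, newton_hull f (x.1, t) -> t <= x.2].

(* The vertices of the upper part of a polytope are the extreme points of the
   polytope that lie on it. *)
Definition complex_vertex f (x : space) : Prop :=
  essential_complex f x /\
  forall y z (t : R), newton_hull f y -> newton_hull f z -> 0 < t < 1 ->
    x = t *: y + (1 - t) *: z -> y = x /\ z = x.

Definition nonvertex_point f m (b : R) : Prop :=
  essential_complex f (expv m, b) /\ ~ complex_vertex f (expv m, b).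

Definition nonvertex_expos f : set (expo n) :=
  [set m | exists b, nonvertex_point f m b].

(* [get] picks the height of the complex above m, which is unique;
   [fset_set] is a total function, but [nonvertex_expos f] is finite by
   [finite_nonvertex_expos] below. *)
Definition closure_ghosts f : tpoly R n :=
  [fsfun m in fset_set (nonvertex_expos f) => Gho (get (nonvertex_point f m))].

Definition full_closure f : tpoly R n :=
  padd (essential_part f) (closure_ghosts f).

Definition full f : Prop := full_closure f = f.

Lemma finite_nonvertex_expos f : finite_set (nonvertex_expos f).
Proof.
pose N := (\sum_(m <- finsupp f) \sum_(i < n) m i)%N.
pose F (u : {ffun 'I_n -> 'I_N.+1}) : expo n := [ffun i => u i : nat].
apply: (@sub_finite_set _ _ (F @` setT)); last first.
  by apply: finite_image; exact: finite_finset.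
move=> m [b [[[w [w0 w1 mE]] _] _]].
have w_le1 p : p \in newton_points f -> w p <= 1.
  move=> pf; rewrite -w1 (big_fsetD1 p) //= lerDl.
  by apply: sumr_ge0 => q _.
suff mN i : (m i <= N)%N.
  exists [ffun i => inord (m i)] => //; apply/ffunP => i.
  by rewrite !ffunE inordK // ltnS.
have fstE : expv m = \sum_(p <- newton_points f) w p *: p.1.
  have -> : expv m = (expv m, b).1 by [].
  by rewrite mE; elim/big_rec2: _ => // p x y _ <-.
have /rowP/(_ i) := fstE; rewrite mxE summxE => miE.
rewrite -(ler_nat R) miE.
apply: (@le_trans _ _ (\sum_(p <- newton_points f) p.1 ord0 i)).
  rewrite big_seq [leRHS]big_seq; apply: ler_sum => p pf; rewrite mxE.
  rewrite ler_piMl ?w_le1//.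
  by case/imfsetP: pf => k _ -> /=; rewrite mxE ler0n.
rewrite /newton_points big_imfset /=; last first.
  move=> p q _ _ [/rowP pq _]; apply/ffunP => j.
  by have := pq j; rewrite !mxE => /eqP; rewrite eqr_nat => /eqP.
rewrite /N natr_sum; apply: ler_sum => p _; rewrite mxE ler_nat.
by rewrite (bigD1 i) //= leq_addr.
Qed.

Lemma essential_partE f m :
  essential_part f m = if `[< essential f m >] then f m else 0.
Proof.
rewrite fsfunE inE /= unfold_in /=; case: asboolP => [[mf _]|_].
  by rewrite andbT; move: mf => /= ->.
by rewrite andbF.
Qed.

Lemma nonvertex_point_inj f m b c :
  nonvertex_point f m b -> nonvertex_point f m c -> b = c.
Proof.
move=> [[hb ub] _] [[hc uc] _]; apply/eqP; rewrite eq_le.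
by rewrite (uc _ hb) (ub _ hc).
Qed.

Lemma closure_ghostsE f m b : nonvertex_point f m b ->
  closure_ghosts f m = Gho b.
Proof.
move=> mb; rewrite fsfunE in_fset_set; last exact: finite_nonvertex_expos.
rewrite mem_set; last by exists b.
by congr Gho; apply: (@nonvertex_point_inj f m); [exact: getI mb|].
Qed.

Lemma closure_ghosts0 f m : ~ (exists b, nonvertex_point f m b) ->
  closure_ghosts f m = 0.
Proof.
move=> mb; rewrite fsfunE in_fset_set; last exact: finite_nonvertex_expos.
by rewrite memNset.
Qed.

(* The carrier of the reduced semiring is the set [full]. *)
Definition fadd f g : tpoly R n := full_closure (padd f g).
Definition fmul f g : tpoly R n := full_closure (pmul f g).
Definition fexp f (k : nat) : tpoly R n := iterop k fmul f pone.

Definition full_ghost : set (tpoly R n) :=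
  [set f | full f /\ forall m, m \in finsupp f -> exists b, f m = Gho b].

Definition tropical_ideal (A : set (tpoly R n)) : Prop :=
  [/\ A `<=` full, A pzero,
      forall f g, A f -> A g -> A (fadd f g)
    & forall h f, full h -> A f -> A (fmul h f)].

Definition finitely_generated (A : set (tpoly R n)) : Prop :=
  exists (s : nat) (f : 'I_s -> tpoly R n), (forall i, full (f i)) /\
    A = [set g | exists h : 'I_s -> tpoly R n, (forall i, full (h i)) /\
                   g = \big[fadd/pzero]_(i < s) fmul (h i) (f i)].

Definition radical (A : set (tpoly R n)) : set (tpoly R n) :=
  [set f | full f /\ exists k : nat, (0 < k)%N /\ A (fexp f k)].

Definition Ztr f : set (tpoint R n) := [set a | Ubar (peval f a)].

Definition Ctr f : set (set (tpoint R n)) :=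
  [set D | (~` Ztr f = set0 /\ D = set0) \/
           exists2 a, (~` Ztr f) a & D = connected_component (~` Ztr f) a].

Definition Ctr_ideal (A : set (tpoly R n)) : set (set (tpoint R n)) :=
  \bigcup_(f in A) Ctr f.

Definition Itr (C : set (set (tpoint R n))) : set (tpoly R n) :=
  [set f | full f /\ forall Df, Ctr f Df -> exists2 D, C D & Df `<=` D].

End Polynomials.

Arguments full_ghost : clear implicits.

(* Main.v *)
(* A full polynomial f is determined by its values at finite tangible points,
   because Farkas' lemma turns domination of monomials on R^n into convex
   combinations of points of the Newton polytope. Evaluation is compatible with
   full closures, so f and its powers are tangible at the same points, and the
   radical is contained in Itr.

   Conversely, the region of R^n where a tangible monomial m dominates f is convex,
   hence lies in one component of f, and so in a component of some g in the ideal.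
   Along this region one monomial q of g dominates, and q only involves variables
   of m. Multiply g by the monomial that turns q into m^k. By Farkas' lemma, the
   excess of the other monomials of g over q is at most a constant times the gap
   between f and m; so for k large the product equals f^k where m dominates f, lies
   strictly below it where m is not maximal, and never exceeds it. The sum of these
   products over m is f^k wherever f is tangible; adding a ghost polynomial, which
   the ideal contains by hypothesis, makes it equal to f^k at all finite tangible points. *)
Require Import Defs.
From mathcomp Require Import all_boot all_order all_algebra finmap.
From mathcomp Require Import all_classical all_reals all_analysis.
From mathcomp Require Import lra ring.

Set Implicit Arguments.
Unset Strict Implicit.
Unset Printing Implicit Defensive.

Import Order.TTheory GRing.Theory Num.Theory.
Import numFieldNormedType.Exports.

Local Open Scope classical_set_scope.
Local Open Scope ring_scope.

(** * Minima and uniform bounds over finite lists *)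

Lemma seq_argmin (R : realType) (T : eqType) (s : seq T) (F : T -> R) :
  s != [::] -> exists2 m, m \in s & forall k, k \in s -> F m <= F k.
Proof.
elim: s => // u [|v s] IH _.
  by exists u; rewrite ?mem_head// => k; rewrite inE => /eqP->.
have [m ms mmin] := IH isT.
have [um|mu] := leP (F u) (F m).
  exists u; rewrite ?mem_head// => k; rewrite inE => /orP[/eqP->//|/mmin].
  exact: le_trans.
exists m; first by rewrite inE ms orbT.
by move=> k; rewrite inE => /orP[/eqP->|/mmin//]; exact: ltW.
Qed.

Lemma seq_uniform (R : realType) (T : eqType) (s : seq T) (P : T -> R -> Prop) :
  (forall p r r', r <= r' -> P p r -> P p r') ->
  (forall p, p \in s -> exists r, P p r) -> exists r, forall p, p \in s -> P p r.
Proof.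
move=> mono; elim: s => [|p s IH] h; first by exists 0.
have [r rp] := h p (mem_head _ _).
have [|r' rs] := IH; first by move=> q qs; apply: h; rewrite inE qs orbT.
exists (Num.max r r') => q; rewrite inE => /orP[/eqP->|/rs Pq].
  by apply: (mono _ r) => //; rewrite le_max lexx.
by apply: (mono _ r') => //; rewrite le_max lexx orbT.
Qed.

(** * Values and sums in the extended tropical semiring *)

Section TropOrder.
Context {R : realType}.
Implicit Types (x y : trop R) (M N : R).

(** [vle], [vlt] and [veq] compare the projection of x to the reals with a real number, -oo lying
    below all reals; they do not distinguish [Tan a] from [Gho a]. *)
Definition vle x M : bool :=
  match x with NegInf => true | Tan a | Gho a => a <= M end.
Definition vlt x M : bool :=
  match x with NegInf => true | Tan a | Gho a => a < M end.
Definition veq x M : bool :=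
  match x with NegInf => false | Tan a | Gho a => a == M end.
Definition tangible x : bool := if x is Tan _ then true else false.

Lemma taddE x y : x + y =
  match x, y with
  | NegInf, _ => y
  | _, NegInf => x
  | Tan a, Tan b => if a == b then Gho a else if a < b then y else x
  | Tan a, Gho b => if a <= b then y else x
  | Gho a, Tan b | Gho a, Gho b => if a < b then y else x
  end.
Proof. exact: trop_addE. Qed.

Lemma tmulE x y : x * y = trop_mul x y. Proof. by []. Qed.

Lemma vltW x M : vlt x M -> vle x M.
Proof. by case: x => //= a; exact: ltW. Qed.

Lemma veqW x M : veq x M -> vle x M.
Proof. by case: x => //= a /eqP->. Qed.

Lemma vlt_veqF x M : vlt x M -> veq x M = false.
Proof. by case: x => //= a; rewrite lt_neqAle => /andP[/negPf]. Qed.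

Lemma veqE x M : veq x M = (x != 0) && (trop_val x == M).
Proof. by case: x. Qed.

Lemma veq_val x : x != 0 -> veq x (trop_val x).
Proof. by rewrite veqE eqxx andbT. Qed.

Lemma vle_eqVlt x M : vle x M = veq x M || vlt x M.
Proof. by case: x => //= a; rewrite le_eqVlt. Qed.

Lemma vleD x y M : vle x M -> vle y M -> vle (x + y) M.
Proof. by rewrite taddE; case: x y => [|a|a] [|b|b] //= *; case: ifP => //= _; case: ifP. Qed.

Lemma vltD x y M : vlt x M -> vlt y M -> vlt (x + y) M.
Proof. by rewrite taddE; case: x y => [|a|a] [|b|b] //= *; case: ifP => //= _; case: ifP. Qed.

Lemma addr_vlt x y M : veq x M -> vlt y M -> x + y = x.
Proof.
rewrite taddE; case: x y => [|a|a] [|b|b] //= /eqP-> ba.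
- by rewrite (gt_eqF ba) ltNge (ltW ba).
- by rewrite leNgt ba.
- by rewrite ltNge (ltW ba).
- by rewrite ltNge (ltW ba).
Qed.

Lemma addr_gho y M : vle y M -> Gho M + y = Gho M.
Proof. by rewrite taddE; case: y => //= b bM; rewrite ltNge bM. Qed.

Lemma addr_veq x y M : veq x M -> veq y M -> x + y = Gho M.
Proof.
by rewrite taddE; case: x y => [|a|a] [|b|b] //= /eqP-> /eqP->;
  rewrite ?eqxx ?lexx ?ltxx.
Qed.

Lemma vleM x y M N : vle x M -> vle y N -> vle (x * y) (M + N).
Proof. by rewrite tmulE; case: x y => [|a|a] [|b|b] //= *; exact: lerD. Qed.

Lemma vltM x y M N : vlt x M -> vle y N -> vlt (x * y) (M + N).
Proof. by rewrite tmulE; case: x y => [|a|a] [|b|b] //= *; exact: ltr_leD. Qed.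

Lemma veqM x y M N : veq x M -> veq y N -> veq (x * y) (M + N).
Proof. by rewrite tmulE; case: x y => [|a|a] [|b|b] //= /eqP-> /eqP->. Qed.

Lemma vleX x M k : vle x M -> vle (x ^+ k) (M *+ k).
Proof. by move=> xM; elim: k => [|k IH] /=; rewrite ?expr0 ?mulr0n//= exprS mulrS vleM. Qed.

Lemma vltX x M k : vlt x M -> vlt (x ^+ k.+1) (M *+ k.+1).
Proof. by move=> xM; rewrite exprS mulrS vltM// vleX// vltW. Qed.

Lemma veqX x M k : veq x M -> veq (x ^+ k) (M *+ k).
Proof. by move=> xM; elim: k => [|k IH] /=; rewrite ?expr0 ?mulr0n//= exprS mulrS veqM. Qed.

Lemma tangibleM x y : tangible (x * y) = tangible x && tangible y.
Proof. by rewrite tmulE; case: x y => [|a|a] [|b|b]. Qed.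

Lemma tangibleX x k : tangible (x ^+ k) = (k == 0%N) || tangible x.
Proof.
by elim: k => // k IH; rewrite exprS tangibleM IH; case: tangible; rewrite ?orbT.
Qed.

Lemma tmul_eq0 x y : (x * y == 0) = (x == 0) || (y == 0).
Proof. by rewrite tmulE; case: x y => [|a|a] [|b|b]. Qed.

Lemma texp_eq0 x k : (x ^+ k == 0) = (k != 0%N) && (x == 0).
Proof.
elim: k => [|k IH]; first by rewrite expr0.
by rewrite exprS tmul_eq0 IH /=; case: (x == 0) => //=; rewrite andbF.
Qed.

Lemma TanX (c : R) k : Tan c ^+ k = Tan (c *+ k).
Proof. by elim: k => // k IH; rewrite exprS IH mulrS. Qed.

Lemma GhoX (c : R) k : Gho c ^+ k.+1 = Gho (c *+ k.+1).
Proof. by elim: k => [|k IH]; rewrite exprS ?IH ?expr0 ?mulrS ?mulr0n //= tmulE /= addr0. Qed.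

Lemma ghostP x M : veq x M -> ~~ tangible x -> x = Gho M.
Proof. by case: x => //= a /eqP->. Qed.

Lemma Ubar_tangible x : Ubar x <-> ~~ tangible x.
Proof.
case: x => [|a|a]; split => //=; first by left.
- by case => // -[].
- by right; exists a.
Qed.

Lemma vle_trans x M N : M <= N -> vle x M -> vle x N.
Proof. by case: x => //= a MN /le_trans; apply. Qed.

Lemma vle_lt_trans x M N : M < N -> vle x M -> vlt x N.
Proof. by case: x => //= a MN /le_lt_trans; apply. Qed.

Lemma veqDl x y M : veq x M -> vle y M -> veq (x + y) M.
Proof.
move=> xM; rewrite vle_eqVlt => /orP[yM|yM]; last by rewrite (addr_vlt xM yM).
by rewrite (addr_veq xM yM); exact: eqxx.
Qed.

Lemma ghost_mul y M : veq y M -> Gho 0 * y = Gho M.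
Proof. by rewrite tmulE; case: y => //= a /eqP->; rewrite add0r. Qed.

(** * Tropical sums over finite lists *)

Section Sums.
Variables (T : eqType).

Lemma vle_sum (s : seq T) (F : T -> trop R) (P : pred T) M : (forall k, k \in s -> P k -> vle (F k) M) ->
  vle (\sum_(k <- s | P k) F k) M.
Proof.
move=> h; rewrite big_seq_cond; elim/big_ind: _ => //; first by move=> *; exact: vleD.
by move=> k /andP[]; exact: h.
Qed.

Lemma vlt_sum (s : seq T) (F : T -> trop R) (P : pred T) M : (forall k, k \in s -> P k -> vlt (F k) M) ->
  vlt (\sum_(k <- s | P k) F k) M.
Proof.
move=> h; rewrite big_seq_cond; elim/big_ind: _ => //; first by move=> *; exact: vltD.
by move=> k /andP[]; exact: h.
Qed.

Lemma veq_sum (s : seq T) (F : T -> trop R) (P : pred T) m M :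
  m \in s -> P m -> veq (F m) M -> (forall k, k \in s -> P k -> vle (F k) M) ->
  veq (\sum_(k <- s | P k) F k) M.
Proof.
move=> ms Pm Fm h; rewrite (big_rem m)//= Pm; apply: veqDl => //.
by apply: vle_sum => k /mem_rem; exact: h.
Qed.

Variables (s : seq T) (F : T -> trop R).

Lemma tsum_unique m M : uniq s -> m \in s -> veq (F m) M ->
  (forall k, k \in s -> k != m -> vlt (F k) M) -> \sum_(k <- s) F k = F m.
Proof.
move=> us ms Fm h; rewrite (bigD1_seq m)//= (@addr_vlt _ _ M)//.
exact: vlt_sum.
Qed.

Lemma tsum_two m1 m2 M : uniq s -> m1 \in s -> m2 \in s -> m1 != m2 ->
  veq (F m1) M -> veq (F m2) M ->
  (forall k, k \in s -> vle (F k) M) -> \sum_(k <- s) F k = Gho M.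
Proof.
move=> us m1s m2s m12 F1 F2 h; rewrite (bigD1_seq m1)//= (big_rem m2)//= eq_sym m12.
rewrite addrA (addr_veq F1 F2) addr_gho//; apply: vle_sum => k /mem_rem ks _.
exact: h.
Qed.

(** Either every term is -oo, or the largest value is attained once, or at least twice. In the last
    two cases [tsum_unique] and [tsum_two] evaluate the sum: it is the maximal term, respectively
    [Gho M]. *)
Lemma tsum_cases : uniq s ->
  [\/ forall k, k \in s -> F k = 0,
      exists m M, [/\ m \in s, veq (F m) M &
                    forall k, k \in s -> k != m -> vlt (F k) M]
    | exists m1 m2 M, [/\ [/\ m1 \in s, m2 \in s & m1 != m2], veq (F m1) M,
         veq (F m2) M & forall k, k \in s -> vle (F k) M]].
Proof.
move=> us; set s' := [seq k <- s | F k != 0].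
have [s0|/(seq_argmin (fun k => - trop_val (F k)))[m]] := eqVneq s' [::].
  constructor 1 => k ks; apply: contrapT => /eqP Fk.
  have : k \in s' by rewrite mem_filter Fk.
  by rewrite s0.
rewrite mem_filter => /andP[Fm ms] mmax.
have le k : k \in s -> vle (F k) (trop_val (F m)).
  move=> ks; have [->//|Fk] := eqVneq (F k) 0.
  have := mmax k; rewrite mem_filter ks Fk lerN2 => /(_ isT).
  by case: (F k).
have [[k [ks km Fk]]|h] := pselect (exists k, [/\ k \in s, k != m & veq (F k) (trop_val (F m))]).
  constructor 3; exists m, k, (trop_val (F m)); split=> //; last exact: veq_val.
  by rewrite eq_sym.
constructor 2; exists m, (trop_val (F m)); split; rewrite ?veq_val// => k ks km.
have := le k ks; rewrite vle_eqVlt => /orP[Fk|//].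
by case: h; exists k.
Qed.

Lemma tsum_tangible c : uniq s -> \sum_(k <- s) F k = Tan c ->
  exists m, [/\ m \in s, F m = Tan c & forall k, k \in s -> k != m -> vlt (F k) c].
Proof.
move=> us; have [F0|[m [M [ms Fm h]]]|[m1 [m2 [M [[? ? ?] ? ? ?]]]]] := tsum_cases us.
- by rewrite big_seq big1.
- rewrite (@tsum_unique m M)// => FT; exists m; split => //.
  by move: Fm; rewrite FT /= => /eqP->.
- by rewrite (@tsum_two m1 m2 M).
Qed.

End Sums.

End TropOrder.

(** This provides the value of the eliminated variable in Fourier-Motzkin elimination: a point
    between the largest lower bound and the smallest upper bound, where either family may be
    empty. *)
Lemma exists_between (R : realType) (T : eqType) (s t : seq T) (L U : T -> R) :
  (forall l u, l \in s -> u \in t -> L l < U u) ->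
  exists x, (forall l, l \in s -> L l < x) /\ (forall u, u \in t -> x < U u).
Proof.
move=> LU.
have [->|/(seq_argmin (fun k => - L k))[l ls lmax]] := eqVneq s [::];
  have [->|/(seq_argmin U)[u ut umin]] := eqVneq t [::].
- by exists 0.
- exists (U u - 1); split => // k /umin; lra.
- by exists (L l + 1); split => // k /lmax; lra.
- have := LU _ _ ls ut => lu; exists ((L l + U u) / 2); split => k.
    by move=> /lmax; lra.
  by move=> /umin; lra.
Qed.

(** * Farkas' lemma and convex hulls *)

Section Affine.
Context {R : realType} {n : nat}.
Local Notation space := (@Defs.space R n).
Implicit Types (u v : space) (x y : 'rV[R]_n) (S : {fset space}).

(* A point of R^(n+1) read as an affine function on R^n, the last coordinate
   being the constant term. *)
Definition aff u x : R := u.2 + \sum_i u.1 0 i * x 0 i.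

Lemma affD u v x : aff (u + v) x = aff u x + aff v x.
Proof.
rewrite /aff /= addrACA -big_split /=; congr (_ + _).
by apply: eq_bigr => i _; rewrite mxE mulrDl.
Qed.

Lemma affZ (c : R) u x : aff (c *: u) x = c * aff u x.
Proof.
rewrite /aff /= mulrDr mulr_sumr; congr (_ + _).
by apply: eq_bigr => i _; rewrite mxE mulrA.
Qed.

Lemma aff0 x : aff 0 x = 0.
Proof. by rewrite -(scale0r 0) affZ mul0r. Qed.

Lemma affB u v x : aff (u - v) x = aff u x - aff v x.
Proof. by rewrite -scaleN1r affD affZ mulN1r. Qed.

Lemma aff_sum (I : Type) (r : seq I) (F : I -> space) x :
  aff (\sum_(i <- r) F i) x = \sum_(i <- r) aff (F i) x.
Proof.
elim: r => [|i r IH]; first by rewrite !big_nil aff0.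
by rewrite !big_cons affD IH.
Qed.

Lemma aff_at0 u : aff u 0 = u.2.
Proof. by rewrite /aff big1 ?addr0// => i _; rewrite mxE mulr0. Qed.

Lemma aff_shift u x j (t : R) :
  aff u (x + t *: delta_mx 0 j) = aff u x + t * u.1 0 j.
Proof.
rewrite /aff -addrA; congr (_ + _).
under eq_bigr => i _ do rewrite !mxE eqxx /= mulrDr.
rewrite big_split /=; congr (_ + _); rewrite (bigD1 j)//= eqxx mulr1 big1 ?addr0.
  by rewrite mulrC.
by move=> i /negPf->; rewrite !mulr0.
Qed.

Lemma aff_convex u x y (t : R) :
  aff u ((1 - t) *: x + t *: y) = (1 - t) * aff u x + t * aff u y.
Proof.
rewrite /aff !mulrDr !mulr_sumr addrACA -big_split /= -mulrDl subrK mul1r.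
by congr (_ + _); apply: eq_bigr => i _; rewrite !mxE; ring.
Qed.

Section Farkas.
Variable K : set space.
Hypothesis KD : forall u v, K u -> K v -> K (u + v).
Hypothesis KZ : forall (c : R) u, 0 < c -> K u -> K (c *: u).

(* Fourier-Motzkin elimination, one variable at a time. *)
Let farkas_rec k (s : seq space) : (forall u, u \in s -> K u) ->
  (forall u, u \in s -> forall i : 'I_n, (k <= i)%N -> u.1 0 i = 0) ->
  (forall x, exists2 u, u \in s & 0 <= aff u x) ->
  exists2 b : R, 0 <= b & K (0, b).
Proof.
elim: k s => [|k IH] s sK s0 sx.
  have [u us] := sx 0; rewrite aff_at0 => u2; exists u.2 => //.
  suff <- : u = (0, u.2) by exact: sK.
  by case: u us {u2} => u1 u2 us; congr pair; apply/rowP => i; rewrite mxE (s0 _ us).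
have [nk|kn] := leqP n k.
  by apply: (IH s) => // u us i ki; have := leq_trans (ltn_ord i) (leq_trans nk ki);
    rewrite ltnn.
pose j := Ordinal kn; pose c u : R := u.1 0 j.
pose z := [seq u <- s | c u == 0]; pose p := [seq u <- s | 0 < c u].
pose q := [seq u <- s | c u < 0].
(* The forms increasing in coordinate [j] are paired with the decreasing ones, with positive weights
   that cancel this coordinate; the forms in [z] do not involve it. *)
pose s' := z ++ [seq c u *: v + - c v *: u | u <- p, v <- q].
apply: (IH s').
- move=> w; rewrite mem_cat => /orP[|/allpairsP[[u v]]].
    by rewrite mem_filter => /andP[_ /sK].
  rewrite !mem_filter /= => -[/andP[cu us] /andP[cv vs] ->].
  by apply: KD; apply: KZ; rewrite ?oppr_gt0//; exact: sK.
- move=> w ws i; rewrite leq_eqVlt => /orP[/eqP ki|ki].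
    have -> : i = j by exact: val_inj.
    move: ws; rewrite mem_cat => /orP[|/allpairsP[[u v] [_ _ ->]]].
      by rewrite mem_filter => /andP[/eqP].
    by rewrite /= !mxE /c; ring.
  move: ws; rewrite mem_cat => /orP[|/allpairsP[[u v]]].
    by rewrite mem_filter => /andP[_ ws]; exact: s0.
  rewrite !mem_filter /= => -[/andP[_ us] /andP[_ vs] ->].
  by rewrite /= !mxE (s0 _ us)// (s0 _ vs)// !mulr0 addr0.
- move=> x; apply: contrapT => h.
  have neg w : w \in s' -> aff w x < 0.
    by move=> ws; rewrite ltNge; apply/negP => w0; apply: h; exists w.
  (* If all forms of [s'] are negative at [x], the bounds that [q] and [p] put on a shift of
     coordinate [j] are compatible, so some shift [t] makes every form of [s] negative. *)
  have [v u vq up|t [tq tp]] := @exists_between R _ q p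
      (fun v => aff v x / - c v) (fun u => - (aff u x / c u)).
    have := neg (c u *: v + - c v *: u).
    have -> : c u *: v + - c v *: u \in s'.
      by rewrite mem_cat; apply/orP; right; apply/allpairsP; exists (u, v).
    move: vq up; rewrite !mem_filter => /andP[cv _] /andP[cu _] /(_ isT).
    rewrite affD !affZ => lt0.
    rewrite -mulNr ltr_pdivrMr ?oppr_gt0// mulrAC ltr_pdivlMr//; lra.
  have [u us] := sx (x + t *: delta_mx 0 j); rewrite aff_shift leNgt => /negP; apply.
  have [cu|cu|cu] := ltgtP (c u) 0.
  + have /tq : u \in q by rewrite mem_filter cu.
    by rewrite ltr_pdivrMr ?oppr_gt0// -/(c u); lra.
  + have /tp : u \in p by rewrite mem_filter cu.
    by rewrite -mulNr ltr_pdivlMr// -/(c u); lra.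
  + by rewrite -/(c u) cu mulr0 addr0 neg// mem_cat mem_filter cu eqxx us.
Qed.

(** An arbitrary cone [K] in place of explicit coefficients lets each application choose as [K] the
    property to be transferred to the constant form [b]. Only positive scalars act on [K], which
    need not contain 0, so the conclusion has content even for b = 0. *)
Lemma farkas (s : seq space) : (forall u, u \in s -> K u) ->
  (forall x, exists2 u, u \in s & 0 <= aff u x) ->
  exists2 b : R, 0 <= b & K (0, b).
Proof.
by move=> sK; apply: (@farkas_rec n) => // u _ i; rewrite leqNgt ltn_ord.
Qed.

End Farkas.

(** * Convex hulls of finite sets *)

Lemma hull_mem S u : u \in S -> convex_hull S u.
Proof.
move=> uS; exists (fun p => (p == u)%:R); split=> [p||].
- exact: ler0n.
- rewrite (big_fsetD1 u)//= eqxx big_seq big1 ?addr0// => p.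
  by rewrite !inE => /andP[/negPf->].
- rewrite (big_fsetD1 u)//= eqxx scale1r big_seq big1 ?addr0// => p.
  by rewrite !inE => /andP[/negPf->]; rewrite scale0r.
Qed.

Lemma hull_mono S S' : (S' `<=` S)%fset -> convex_hull S' `<=` convex_hull S.
Proof.
move=> SS u [w [w0 w1 uE]]; exists (fun p => if p \in S' then w p else 0).
have e (V : zmodType) (F : space -> V) : (forall p, p \notin S' -> F p = 0) ->
    \sum_(p <- S) F p = \sum_(p <- S') F p.
  by move=> F0; apply/esym/big_fset_incl => // p _ /F0.
split => [p||].
- by case: ifP.
- rewrite e; last by move=> p /negPf->.
  by rewrite -w1 big_seq [RHS]big_seq; apply: eq_bigr => p ->.
- rewrite e; last by move=> p /negPf->; rewrite scale0r.
  by rewrite uE big_seq [RHS]big_seq; apply: eq_bigr => p ->.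
Qed.

(** Some p in [S'] has positive weight in x. If its weight is less than 1, x lies strictly between p
    and the renormalized combination of the other points, so extremality forces p = x. The smaller
    set [S'] allows an application to a polynomial with one monomial removed. *)
Lemma hull_extreme S S' (x : space) : (S' `<=` S)%fset -> convex_hull S' x ->
  (forall (y z : space) (t : R), convex_hull S y -> convex_hull S z -> 0 < t < 1 ->
     x = t *: y + (1 - t) *: z -> y = x /\ z = x) -> x \in S'.
Proof.
move=> SS [w [w0 w1 xE]] ext.
have [p pS wp] : exists2 p, p \in S' & w p != 0.
  apply: contrapT => h; have := oner_neq0 R; rewrite -w1 big_seq big1 ?eqxx// => p pS.
  by apply: contrapT => /eqP wp; apply: h; exists p.
have wp0 : 0 < w p by rewrite lt_def wp w0.
have wD1 : \sum_(q <- (S' `\ p)%fset) w q = 1 - w p.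
  by rewrite -w1 [X in X - _](big_fsetD1 p)//= addrAC subrr add0r.
have xD : x = w p *: p + \sum_(q <- (S' `\ p)%fset) w q *: q by rewrite xE (big_fsetD1 p).
have : w p <= 1 by rewrite -subr_ge0 -wD1 sumr_ge0.
rewrite le_eqVlt => /orP[/eqP wp1|wp1].
  suff -> : x = p by [].
  rewrite xD wp1 scale1r big_seq big1 ?addr0// => q qS.
  suff -> : w q = 0 by rewrite scale0r.
  apply/eqP; move: wD1; rewrite wp1 subrr => /eqP.
  rewrite psumr_eq0; last by move=> i _; exact: w0.
  by move=> /allP/(_ q qS).
pose z := (1 - w p)^-1 *: \sum_(q <- (S' `\ p)%fset) w q *: q.
have wpV : 1 - w p != 0 by rewrite subr_eq0 eq_sym lt_eqF.
have [] := ext p z (w p); rewrite ?wp0 ?wp1//.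
- by apply: hull_mem; exact: (fsubsetP SS).
- apply: (@hull_mono S (S' `\ p)%fset).
    by apply: fsubset_trans SS; exact: fsubsetDl.
  exists (fun q => (1 - w p)^-1 * w q); split => [q||].
  + by rewrite mulr_ge0// invr_ge0 subr_ge0 ltW.
  + by rewrite -mulr_sumr wD1 mulVf.
  + by rewrite /z scaler_sumr; apply: eq_bigr => q _; rewrite scalerA.
- by rewrite /z scalerA mulfV// scale1r.
- by move=> <-.
Qed.

(** Farkas' lemma for the combinations of the vectors p - u yields weights of positive total W whose
    combination is (0, b) with b >= 0. Division by W gives a point of the hull over [u.1] at height
    [u.2] + b/W. *)
Lemma hull_above S u : (forall x, exists2 p, p \in S & aff u x <= aff p x) ->
  exists2 t : R, u.2 <= t & convex_hull S (u.1, t).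
Proof.
move=> h; pose K : set space := [set v | exists w : space -> R,
  [/\ forall p, 0 <= w p, 0 < \sum_(p <- S) w p & v = \sum_(p <- S) w p *: (p - u)]].
have [|||x|b b0 [w [w0 W0 bE]]] := @farkas K _ _ [seq p - u | p <- S].
- move=> v v' [w [w0 w1 ->]] [w' [w0' w1' ->]]; exists (fun p => w p + w' p).
  split=> [p||]; first exact: addr_ge0.
    by rewrite big_split /= addr_gt0.
  by rewrite -big_split /=; apply: eq_bigr => p _; rewrite scalerDl.
- move=> c v c0 [w [w0 w1 ->]]; exists (fun p => c * w p).
  split=> [p||]; first by rewrite mulr_ge0// ltW.
    by rewrite -mulr_sumr mulr_gt0.
  by rewrite scaler_sumr; apply: eq_bigr => p _; rewrite scalerA.
- move=> v /mapP[p pS ->]; exists (fun q => (q == p)%:R); split=> [q||].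
  + exact: ler0n.
  + rewrite (big_fsetD1 p)//= eqxx big_seq big1 ?addr0// => q.
    by rewrite !inE => /andP[/negPf->].
  + rewrite (big_fsetD1 p)//= eqxx scale1r big_seq big1 ?addr0// => q.
    by rewrite !inE => /andP[/negPf->]; rewrite scale0r.
- have [p pS le] := h x; exists (p - u); first exact: map_f.
  by rewrite affB subr_ge0.
set W := \sum_(p <- S) w p in W0.
have Wn : W != 0 by rewrite gt_eqF.
have E : \sum_(p <- S) w p *: p = W *: u + (0, b).
  rewrite bE; under [X in _ = _ + X]eq_bigr do rewrite scalerBr.
  by rewrite big_split /= sumrN -scaler_suml addrCA subrr addr0.
exists (u.2 + W^-1 * b); first by rewrite lerDl mulr_ge0// invr_ge0 ltW.
exists (fun p => W^-1 * w p); split => [p||].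
- by rewrite mulr_ge0// invr_ge0 ltW.
- by rewrite -mulr_sumr mulVf.
- under eq_bigr do rewrite -scalerA.
  rewrite -scaler_sumr E scalerDr scalerA mulVf// scale1r.
  congr pair => /=.
    by rewrite scaler0 addr0.
Qed.

End Affine.

(** * Evaluation of polynomials *)

Section Evaluation.
Context {R : realType} {n : nat}.
Local Notation space := (@Defs.space R n).
Implicit Types (f g h : tpoly R n) (m p q : expo n) (a : tpoint R n) (x : 'rV[R]_n).

Definition mono a m : trop R := \prod_(i < n) a i ^+ m i.
Definition term f a m : trop R := f m * mono a m.
Definition alive a m : bool := [forall i, (a i == 0) ==> (m i == 0)%N].
(* 0 is a dummy at the coordinates equal to -oo; [alive] excludes the monomials
   that involve them. *)
Definition coords a : 'rV[R]_n := \row_i trop_val (a i).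
(** This point generates the Newton polytope; read through [aff], it is also the monomial as an
    affine function on R^n. *)
Definition graph_pt f m : space := (expv m, trop_val (f m)).
Definition tanpt x : tpoint R n := fun i => Tan (x 0 i).

Lemma mono0 a : mono a 0 = 1.
Proof. by rewrite /mono big1// => i _; rewrite ffunE expr0. Qed.

Lemma monoD a p q : mono a (p + q) = mono a p * mono a q.
Proof. by rewrite /mono -big_split; apply: eq_bigr => i _; rewrite ffunE exprD. Qed.

Lemma mono_eq0 a m : (mono a m == 0) = ~~ alive a m.
Proof.
rewrite /mono negb_forall; under [RHS]eq_existsb => i do rewrite negb_imply andbC.
apply/idP/existsP => [|[i]]; last first.
  by rewrite -texp_eq0 (bigD1 i)//= tmul_eq0 => ->.
elim/big_rec: _ => // i y _ IH; rewrite tmul_eq0 texp_eq0 => /orP[|/IH//].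
by exists i.
Qed.

Lemma mono_veq a m : alive a m ->
  veq (mono a m) (\sum_i expv m 0 i * coords a 0 i).
Proof.
move=> /forallP am; rewrite /mono; elim/big_rec2: _ => [|i y z _ IH]; first exact: eqxx.
apply: veqM => //; rewrite !mxE mulr_natl.
have [a0|a0] := eqVneq (a i) 0; last by apply/veqX/veq_val.
have := am i; rewrite a0 eqxx /= => /eqP->; rewrite expr0 mulr0n; exact: eqxx.
Qed.

Lemma term_eq0 f a m : (term f a m == 0) = (f m == 0) || ~~ alive a m.
Proof. by rewrite /term tmul_eq0 mono_eq0. Qed.

Lemma term_veq f a m : term f a m != 0 ->
  veq (term f a m) (aff (graph_pt f m) (coords a)).
Proof.
rewrite term_eq0 negb_or negbK => /andP[fm am].
by apply: veqM; [exact: veq_val|exact: mono_veq].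
Qed.

Lemma finsuppN0 f m : (m \in finsupp f) = (f m != 0).
Proof. by rewrite mem_finsupp. Qed.

Lemma alive_term f a m : m \in finsupp f -> alive a m ->
  veq (term f a m) (aff (graph_pt f m) (coords a)).
Proof. by rewrite finsuppN0 => fm am; apply: term_veq; rewrite term_eq0 negb_or fm negbK. Qed.

Lemma alive_tan x m : alive (tanpt x) m.
Proof. by apply/forallP. Qed.

Lemma coords_tan x : coords (tanpt x) = x.
Proof. by apply/rowP => i; rewrite mxE. Qed.

Lemma tan_term f x m : m \in finsupp f ->
  veq (term f (tanpt x) m) (aff (graph_pt f m) x).
Proof. by move=> fm; have := alive_term fm (alive_tan x m); rewrite coords_tan. Qed.

Lemma mono_tan x m : mono (tanpt x) m = Tan (\sum_i expv m 0 i * x 0 i).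
Proof.
rewrite /mono; elim/big_rec2: _ => // i y z _ ->.
by rewrite /tanpt TanX !mxE mulr_natl tmulE.
Qed.

Lemma peval_sup f a (X : {fset expo n}) : (finsupp f `<=` X)%fset ->
  peval f a = \sum_(m <- X) term f a m.
Proof.
move=> fX; apply: big_fset_incl => // m _; rewrite finsuppN0 negbK => /eqP->.
exact: mul0r.
Qed.

Lemma peval_pzero a : peval (pzero : tpoly R n) a = 0.
Proof. by rewrite (@peval_sup _ _ fset0) ?big_nil// finsupp0. Qed.

Lemma peval_padd f g a : peval (padd f g) a = peval f a + peval g a.
Proof.
set X := (finsupp f `|` finsupp g)%fset.
have sub : (finsupp (padd f g) `<=` X)%fset.
  apply/fsubsetP => m; rewrite inE !finsuppN0 paddE.
  by have [->|//] := eqVneq (f m) 0; rewrite add0r.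
rewrite (peval_sup _ sub) (peval_sup _ (fsubsetUl _ _ : (_ `<=` X)%fset)).
rewrite (peval_sup _ (fsubsetUr _ _ : (_ `<=` X)%fset)) -big_split /=.
by apply: eq_bigr => m _; rewrite /term paddE mulrDl.
Qed.

Lemma peval_pmul f g a : peval (pmul f g) a = peval f a * peval g a.
Proof.
set X := [fset (p + q)%R | p in finsupp f, q in finsupp g]%fset.
have sub : (finsupp (pmul f g) `<=` X)%fset by exact: finsupp_sub.
rewrite (peval_sup _ sub) /term.
under eq_bigr => m _.
  rewrite pmulE mulr_suml.
  under eq_bigr do rewrite mulr_suml.
  over.
rewrite exchange_big /= /peval mulr_suml big_seq [RHS]big_seq.
apply: eq_bigr => p pf; rewrite mulr_sumr.
rewrite (exchange_big_dep xpredT)//= big_seq [RHS]big_seq; apply: eq_bigr => q qg.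
rewrite big_mkcond (big_fsetD1 (p + q))/=; last by apply/imfset2P; exists p => //; exists q.
rewrite eqxx big_seq big1 ?addr0; last first.
  by move=> m; rewrite !inE eq_sym => /andP[/negPf->].
by rewrite -/(mono a (p + q)) monoD mulrACA.
Qed.

Lemma term_pmon m c a : peval (pmon m c) a = c * mono a m.
Proof.
rewrite (@peval_sup _ _ [fset m]%fset); last first.
  apply/fsubsetP => k; rewrite finsuppN0 pmonE inE.
  by case: (k == m) => //; rewrite eqxx.
by rewrite big_seq_fset1 /term pmonE eqxx.
Qed.

(** * Convex weights on the monomials *)

Definition hull_weights f (v : space) (w : expo n -> R) :=
  [/\ forall p, 0 <= w p, \sum_(p <- finsupp f) w p = 1 &
      v = \sum_(p <- finsupp f) w p *: graph_pt f p].

Lemma expv_inj : injective (@expv R n).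
Proof.
move=> p q /rowP pq; apply/ffunP => i; have := pq i; rewrite !mxE => /eqP.
by rewrite eqr_nat => /eqP.
Qed.

Lemma graph_pt_inj f : injective (graph_pt f).
Proof. by move=> p q [/expv_inj]. Qed.

Lemma newton_pointP f v :
  reflect (exists2 m, m \in finsupp f & v = graph_pt f m) (v \in newton_points f).
Proof. by apply: (iffP (imfsetP _ _ _ _)) => -[m mf ->]; exists m. Qed.

Lemma graph_newton f m : m \in finsupp f -> graph_pt f m \in newton_points f.
Proof. by move=> mf; apply/newton_pointP; exists m. Qed.

Lemma hull_weightsP f v : newton_hull f v -> exists w, hull_weights f v w.
Proof.
move=> [w [w0 w1 vE]]; exists (w \o graph_pt f); split=> [p||] /=; first exact: w0.
- by rewrite -w1 big_imfset //=; move=> p q _ _; exact: graph_pt_inj.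
- by rewrite vE big_imfset //=; move=> p q _ _; exact: graph_pt_inj.
Qed.

(** The weights have total 1 and [aff] is linear in the point, so the slacks below c average to that
    of v. If they are nonnegative and their average is 0, every monomial of positive weight has the
    value c. *)
Lemma weights_slack f (v : space) w x (c : R) : hull_weights f v w ->
  \sum_(p <- finsupp f) w p * (c - aff (graph_pt f p) x) = c - aff v x.
Proof.
move=> [_ w1 ->]; rewrite aff_sum; under eq_bigr do rewrite mulrBr.
by rewrite big_split /= sumrN -mulr_suml w1 mul1r; under [in RHS]eq_bigr do rewrite affZ.
Qed.

Lemma weights_single f (v : space) w m : hull_weights f v w -> m \in finsupp f ->
  (forall p, p \in finsupp f -> p != m -> w p = 0) -> v = graph_pt f m.
Proof.
move=> [_ w1 ->] mf wN.
have rest p : p \in (finsupp f `\ m)%fset -> w p = 0.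
  by rewrite !inE => /andP[pm pf]; exact: wN.
have wm : w m = 1 by rewrite -w1 (big_fsetD1 m)//= big_seq big1 ?addr0.
rewrite (big_fsetD1 m)//= wm scale1r big_seq big1 ?addr0//.
by move=> p /rest->; rewrite scale0r.
Qed.

Section HullWeights.
Variables (f : tpoly R n) (m : expo n) (t : R) (w : expo n -> R).
Hypothesis mw : hull_weights f (expv m, t) w.

Lemma weights_pos : exists2 p, p \in finsupp f & 0 < w p.
Proof.
have [w0 w1 _] := mw; apply: contrapT => h.
have := oner_neq0 R; rewrite -w1 big_seq big1 ?eqxx// => p pf.
by apply/eqP; rewrite eq_le w0 andbT leNgt; apply/negP => wp; apply: h; exists p.
Qed.

(** Exponents are nonnegative, so a variable absent from m is absent from every monomial that has
    positive weight in a point over m. *)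
Lemma weights_alive a p : alive a m -> p \in finsupp f -> 0 < w p -> alive a p.
Proof.
have [w0 _ vE] := mw; move=> /forallP am pf wp; apply/forallP => i; apply/implyP => ai.
have := am i; rewrite ai /= => /eqP mi.
have /rowP/(_ i) : expv m = \sum_(p <- finsupp f) w p *: expv p.
  have -> : expv m = (expv m, t).1 by [].
  by rewrite vE; elim/big_rec2: _ => // q x y _ <-.
rewrite mxE mi summxE => /esym/eqP; rewrite psumr_eq0; last first.
  by move=> q _; rewrite !mxE mulr_ge0.
move=> /allP/(_ p pf); rewrite /= !mxE mulf_eq0 pnatr_eq0.
by rewrite gt_eqF.
Qed.

Variables (a : tpoint R n) (M : R).
Hypothesis am : alive a m.
Hypothesis fM : forall p, p \in finsupp f -> vle (term f a p) M.

Let slack p := w p * (M - aff (graph_pt f p) (coords a)).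

Let slack_ge0 p : p \in finsupp f -> 0 <= slack p.
Proof.
move=> pf; have [w0 _ _] := mw; rewrite /slack.
(* A monomial of weight 0 may fail to be alive at [a], and then the bound on its term says nothing
   about its affine value. *)
have := w0 p; rewrite le_eqVlt => /orP[/eqP<-|wp]; first by rewrite mul0r.
rewrite mulr_ge0// subr_ge0.
have := alive_term pf (weights_alive am pf wp); have := fM pf.
by case: term => //= b bM /eqP<-.
Qed.

Let slackE : \sum_(p <- finsupp f) slack p = M - aff (expv m, t) (coords a).
Proof. exact: weights_slack mw. Qed.

Lemma weights_le : aff (expv m, t) (coords a) <= M.
Proof. by rewrite -subr_ge0 -slackE big_seq sumr_ge0. Qed.

Lemma weights_eq p : aff (expv m, t) (coords a) = M -> p \in finsupp f -> 0 < w p ->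
  veq (term f a p) M.
Proof.
move=> tM pf wp; have := slackE; rewrite tM subrr => /eqP.
rewrite big_seq psumr_eq0; last exact: slack_ge0.
move=> /allP/(_ p pf)/implyP/(_ pf); rewrite mulf_eq0 gt_eqF//= subr_eq0 => /eqP->.
exact: alive_term (weights_alive am pf wp).
Qed.

(** When the point over m reaches the bound M, all slacks vanish, so only [m0] carries weight and
    the point is that of [m0]. *)
Lemma weights_unique m0 : aff (expv m, t) (coords a) = M ->
  (forall p, p \in finsupp f -> p != m0 -> vlt (term f a p) M) -> m = m0.
Proof.
move=> tM h; have [w0 w1 vE] := mw.
have wN p : p \in finsupp f -> p != m0 -> w p = 0.
  move=> pf pm; apply/eqP; rewrite eq_le w0 andbT leNgt; apply/negP => wp.
  by have := weights_eq tM pf wp; rewrite vlt_veqF// h.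
have [p pf wp] := weights_pos.
have pm : p = m0 by apply/eqP; apply: contrapT => /negP /(wN _ pf) e; rewrite e ltxx in wp.
subst p; by have [/expv_inj] := weights_single mw pf wN.
Qed.

End HullWeights.

End Evaluation.

(** * Essential monomials, vertices and full closures *)

Section FullClosure.
Context {R : realType} {n : nat}.
Local Notation space := (@Defs.space R n).
Implicit Types (f g h : tpoly R n) (m p q k : expo n) (a : tpoint R n) (x : 'rV[R]_n).

Definition dominant f m x := m \in finsupp f /\
  forall k, k \in finsupp f -> k != m -> aff (graph_pt f k) x < aff (graph_pt f m) x.

Lemma dominant_vlt f m x : dominant f m x -> forall k, k \in finsupp f -> k != m ->
  vlt (term f (tanpt x) k) (aff (graph_pt f m) x).
Proof.
move=> [_ h] k kf km; have := tan_term x kf; have := h k kf km.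
by case: term => //= b + /eqP->.
Qed.

Lemma peval_dominant f m x : dominant f m x ->
  peval f (tanpt x) = term f (tanpt x) m.
Proof.
move=> mx; apply: (@tsum_unique _ _ _ _ m (aff (graph_pt f m) x)).
- exact: fset_uniq.
- exact: mx.1.
- by apply: tan_term; exact: mx.1.
- exact: dominant_vlt.
Qed.

Lemma newton_above f (u : space) :
  (forall x, exists2 k, k \in finsupp f & aff u x <= aff (graph_pt f k) x) ->
  exists2 t, u.2 <= t & newton_hull f (u.1, t).
Proof.
move=> h; apply: hull_above => x; have [k kf le] := h x.
by exists (graph_pt f k); first exact: graph_newton.
Qed.

Lemma pdrop_supp f m k : (k \in finsupp (pdrop f m)) = (k != m) && (k \in finsupp f).
Proof. by rewrite !finsuppN0 pdropE; case: (k == m); rewrite ?eqxx. Qed.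

Lemma pdrop_term f m k a : k != m -> term (pdrop f m) a k = term f a k.
Proof. by move=> /negPf km; rewrite /term pdropE km. Qed.

Lemma pdrop_newton f m : (newton_points (pdrop f m) `<=` newton_points f)%fset.
Proof.
apply/fsubsetP => u /newton_pointP[k]; rewrite pdrop_supp => /andP[/negPf km kf] ->.
by rewrite /graph_pt pdropE km; exact: graph_newton.
Qed.

Lemma newton_mem f m : m \in finsupp f -> newton_hull f (graph_pt f m).
Proof. by move=> mf; apply/hull_mem/graph_newton. Qed.

(** At every x some other monomial is at least as large as m, which is the hypothesis of
    [newton_above] for f without m. *)
Lemma nondominant_below f m : m \in finsupp f -> (forall x, ~ dominant f m x) ->
  exists2 t, trop_val (f m) <= t & newton_hull (pdrop f m) (expv m, t).
Proof.
move=> mf nd; apply: (@newton_above _ (graph_pt f m)) => x; apply: contrapT => h.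
apply: (nd x); split => // k kf km; rewrite ltNge; apply/negP => le; apply: h.
exists k; rewrite ?pdrop_supp ?km//.
by have -> : graph_pt (pdrop f m) k = graph_pt f k by rewrite /graph_pt pdropE (negPf km).
Qed.

(** Otherwise the polytope of f without m has a point over m at least as high as that of m. Its
    weights show that the other monomials dominate m at every [a], including points with -oo
    coordinates: a single maximum among them is strictly above m by [weights_unique], and two tied
    maxima give a ghost that absorbs m. *)
Lemma essential_dominant f m : essential f m -> exists x, dominant f m x.
Proof.
move=> [mf ness]; apply: contrapT => /forallNP nd; apply: ness.
have [t tm mt] := nondominant_below mf nd; have [w mw] := hull_weightsP mt.
have [k kf wk] := weights_pos mw.
split; first by move=> e; move: kf; rewrite e finsupp0.
move=> a; rewrite term_pmon -/(term f a m).
have [->|fm0] := eqVneq (term f a m) 0; first by rewrite addr0.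
have am : alive a m by move: fm0; rewrite term_eq0 negb_or negbK => /andP[].
have fle : aff (graph_pt f m) (coords a) <= aff (expv m, t) (coords a).
  by rewrite /aff lerD2r.
have ft := term_veq fm0.
have [g0|[m0 [M [m0g m0M gM]]]|[m1 [m2 [M [[m1g m2g m12] m1M m2M gM]]]]] :=
    tsum_cases (term (pdrop f m) a) (fset_uniq (finsupp (pdrop f m))).
- have := alive_term kf (weights_alive mw am kf wk).
  by rewrite g0.
- have gM' p : p \in finsupp (pdrop f m) -> vle (term (pdrop f m) a p) M.
    move=> pg; have [->|pm] := eqVneq p m0; first exact: veqW.
    by apply: vltW; exact: gM.
  have ev : peval (pdrop f m) a = term (pdrop f m) a m0 by exact: tsum_unique (fset_uniq _) m0g m0M gM.
  rewrite ev; apply: addr_vlt m0M _.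
  have := weights_le mw am gM'; rewrite le_eqVlt => /orP[/eqP e|lt].
    by have := m0g; rewrite -(weights_unique mw am gM' e gM) pdrop_supp eqxx.
  by have := le_lt_trans fle lt; case: (term f a m) ft => //= b /eqP->.
- have -> : peval (pdrop f m) a = Gho M by exact: tsum_two (fset_uniq _) m1g m2g m12 m1M m2M gM.
  apply: addr_gho; have := le_trans fle (weights_le mw am gM).
  by case: (term f a m) ft => //= b /eqP->.
Qed.

Lemma unique_essential f m a M : m \in finsupp f -> veq (term f a m) M ->
  (forall k, k \in finsupp f -> k != m -> vlt (term f a k) M) -> essential f m.
Proof.
move=> mf mM h; split => // -[_ /(_ a)].
have gM : vlt (peval (pdrop f m) a) M.
  apply: vlt_sum => k; rewrite pdrop_supp => /andP[km kf] _.
  by rewrite -/(mono a k) -/(term _ a k) pdrop_term// h.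
rewrite addrC term_pmon -/(term f a m) (addr_vlt mM gM) => e.
by rewrite e vlt_veqF in mM.
Qed.

Lemma dominant_essential f m x : dominant f m x -> essential f m.
Proof.
move=> mx; apply: (@unique_essential f m (tanpt x) (aff (graph_pt f m) x)).
- exact: mx.1.
- by apply: tan_term; exact: mx.1.
- exact: dominant_vlt.
Qed.

Lemma newton_le f (v : space) x : newton_hull f v ->
  exists2 k, k \in finsupp f & aff v x <= aff (graph_pt f k) x.
Proof.
move=> /hull_weightsP[w vw]; have [w0 w1 _] := vw; apply: contrapT => h.
have lt k : k \in finsupp f -> aff (graph_pt f k) x < aff v x.
  by move=> kf; rewrite ltNge; apply/negP => le; apply: h; exists k.
have /eqP := weights_slack x (aff v x) vw.
rewrite subrr big_seq psumr_eq0; last first.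
  by move=> p pf; rewrite mulr_ge0// subr_ge0 ltW ?lt.
move=> /allP s0; have := oner_neq0 R; rewrite -w1 big_seq big1 ?eqxx// => p pf.
have := s0 p pf; rewrite pf mulf_eq0 /= => /orP[/eqP//|].
by rewrite subr_eq0 gt_eqF// lt.
Qed.

(** At a point x where m dominates, the linear functional [aff ^~ x] has its unique maximum on the
    Newton polytope at the point of m, which is therefore extreme. *)
Lemma essential_vertex f m (b : R) : essential f m ->
  essential_complex f (expv m, b) -> complex_vertex f (expv m, b).
Proof.
move=> /essential_dominant[x [mf dom]] mb; split => //.
have le v : newton_hull f v -> aff v x <= aff (graph_pt f m) x.
  move=> /(newton_le x)[k kf vk]; apply: le_trans vk _.
  by have [->//|km] := eqVneq k m; rewrite ltW// dom.
have eq v : newton_hull f v -> aff v x = aff (graph_pt f m) x -> v = graph_pt f m.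
  move=> /hull_weightsP[w vw] e; have [w0 w1 _] := vw.
  apply: (weights_single vw mf) => p pf pm.
  have /eqP := weights_slack x (aff (graph_pt f m) x) vw.
  rewrite e subrr big_seq psumr_eq0; last first.
    move=> q qf; rewrite mulr_ge0// subr_ge0.
    by have [->//|qm] := eqVneq q m; rewrite ltW ?dom.
  move=> /allP/(_ p pf); rewrite pf mulf_eq0 /= => /orP[/eqP//|].
  by rewrite subr_eq0 gt_eqF// dom.
have bE : (expv m, b) = graph_pt f m.
  apply: eq; first exact: mb.1; apply/eqP; rewrite eq_le (le _ mb.1) /=.
  by rewrite /aff lerD2r; apply: mb.2; exact: newton_mem.
move=> y z t fy fz /andP[t0 t1]; rewrite bE => e.
have := congr1 (aff ^~ x) e; rewrite /= affD !affZ => e'.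
have ly := le _ fy; have lz := le _ fz.
by split; apply: eq => //; nra.
Qed.

(** A vertex is a generating point by [hull_extreme]. Were its monomial inessential, the polytope of
    the other monomials would contain a point over m at least as high, hence the vertex itself, and
    [hull_extreme] would make it the point of another monomial. *)
Lemma vertex_essential f m (b : R) : complex_vertex f (expv m, b) -> essential f m.
Proof.
move=> [[mb mmax] ext]; have := hull_extreme (fsubset_refl _) mb ext.
move=> /newton_pointP[k kf [/expv_inj e bE]]; subst k b; apply: contrapT => ness.
have [t tm mt] := nondominant_below kf (fun x mx => ness (dominant_essential mx)).
have tE : t = trop_val (f m).
  by apply/eqP; rewrite eq_le tm andbT; apply: mmax; exact: hull_mono (@pdrop_newton f m) _ mt.
move: mt; rewrite tE => mt; have := hull_extreme (@pdrop_newton f m) mt ext.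
by move=> /newton_pointP[k]; rewrite pdrop_supp => /andP[/eqP km _] [/expv_inj/esym].
Qed.

Lemma full_closure_essential f m : essential f m -> full_closure f m = f m.
Proof.
move=> em; rewrite paddE essential_partE asboolT// closure_ghosts0 ?addr0//.
by move=> [b [cb]]; apply; exact: essential_vertex.
Qed.

Lemma full_closure_ghost f m b : nonvertex_point f m b -> full_closure f m = Gho b.
Proof.
move=> mb; rewrite paddE essential_partE asboolF ?(closure_ghostsE mb) ?add0r//.
by move=> em; case: mb => cb; apply; exact: essential_vertex.
Qed.

Lemma full_closure_eq0 f m : ~ essential f m -> ~ (exists b, nonvertex_point f m b) ->
  full_closure f m = 0.
Proof. by move=> em mb; rewrite paddE essential_partE asboolF// closure_ghosts0// addr0. Qed.

Lemma full_closure_cases f m : m \in finsupp (full_closure f) ->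
  (essential f m /\ full_closure f m = f m) \/
  exists2 b, nonvertex_point f m b & full_closure f m = Gho b.
Proof.
rewrite finsuppN0 => fm.
have [em|em] := pselect (essential f m); first by left; rewrite full_closure_essential.
have [[b mb]|mb] := pselect (exists b, nonvertex_point f m b).
  by right; exists b; rewrite ?(full_closure_ghost mb).
by rewrite full_closure_eq0 ?eqxx in fm.
Qed.

(** By [weights_le] no point of the polytope over m is higher than the point of a monomial attaining
    the maximum at [a]. So this point is on the essential complex, and m survives: unchanged when
    essential, as a ghost of the same value otherwise. *)
Lemma attained_full_closure f m a M : m \in finsupp f -> veq (term f a m) M ->
  (forall k, k \in finsupp f -> vle (term f a k) M) ->
  m \in finsupp (full_closure f) /\ veq (term (full_closure f) a m) M /\
  (~ essential f m -> term (full_closure f) a m = Gho M).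
Proof.
move=> mf mM fM; have m0 : term f a m != 0 by case: term mM.
have am : alive a m by move: m0; rewrite term_eq0 negb_or negbK => /andP[].
have [em|em] := pselect (essential f m).
  by rewrite finsuppN0 /term full_closure_essential// -finsuppN0; split.
have mb : nonvertex_point f m (trop_val (f m)).
  split; last by move=> /vertex_essential.
  split; first exact: newton_mem.
  move=> t /= /hull_weightsP[w mw]; have := weights_le mw am fM.
  have := term_veq m0; move: mM; case: term => //= c /eqP-> /eqP ->;
  by rewrite /aff lerD2r.
have cE := full_closure_ghost mb.
have tE : veq (term (full_closure f) a m) M.
  have : veq (term f a m) (aff (graph_pt f m) (coords a)) by exact: term_veq.
  have : veq (term (full_closure f) a m) (aff (graph_pt f m) (coords a)).
    suff -> : graph_pt f m = graph_pt (full_closure f) m.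
      by apply: term_veq; rewrite term_eq0 am cE.
    by rewrite /graph_pt cE.
  by case: term => //= c /eqP->; case: term mM => //= d /eqP-> /eqP->.
split; first by rewrite finsuppN0 cE.
split=> // _; apply: ghostP tE _.
by rewrite /term cE tangibleM.
Qed.

(** The added ghosts lie at convex combinations of monomials, so they never exceed the maximum of f.
    A unique maximum is essential, is kept and stays unique by [weights_unique]; two tied maxima
    both survive and give the same ghost. If every term of f is -oo, no added ghost is alive. *)
Lemma peval_full_closure f a : peval (full_closure f) a = peval f a.
Proof.
have hull_ghost m b : nonvertex_point f m b -> exists w, hull_weights f (expv m, b) w.
  by move=> [[/hull_weightsP]].
set F := full_closure f.
have ghost_val m b : nonvertex_point f m b -> alive a m ->
    term F a m = Gho (aff (expv m, b) (coords a)).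
  move=> mb am; have cE := full_closure_ghost mb.
  have -> : (expv m, b) = graph_pt F m by rewrite /graph_pt cE.
  apply: ghostP; first by apply: term_veq; rewrite term_eq0 cE am.
  by rewrite /term cE tangibleM.
have Fle M : (forall k, k \in finsupp f -> vle (term f a k) M) ->
    forall k, k \in finsupp F -> vle (term F a k) M.
  move=> fM k kF; have [[ek FE]|[b kb FE]] := full_closure_cases kF.
    by rewrite /term FE; apply: fM; exact: ek.1.
  have [ak|ak] := boolP (alive a k).
    rewrite (ghost_val _ _ kb ak) /=; have [w kw] := hull_ghost _ _ kb.
    by have := weights_le kw ak fM.
  by move: (term_eq0 F a k); rewrite ak orbT => /eqP->.
have [f0|[m0 [M [m0f m0M fM]]]|[m1 [m2 [M [[m1f m2f m12] m1M m2M fM]]]]] :=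
    tsum_cases (term f a) (fset_uniq (finsupp f)).
- rewrite /peval big_seq [RHS]big_seq [RHS]big1// big1// => k kF.
  have [[ek FE]|[b kb FE]] := full_closure_cases kF.
    by rewrite FE; apply: f0; exact: ek.1.
  apply/eqP; rewrite -/(mono a k) -/(term F a k) term_eq0; apply/orP; right.
  apply/negP => ak; have [w kw] := hull_ghost _ _ kb.
  have [p pf wp] := weights_pos kw.
  by have := alive_term pf (weights_alive kw ak pf wp); rewrite f0.
- have em : essential f m0 by exact: unique_essential m0f m0M fM.
  have FE := full_closure_essential em.
  have fM' p : p \in finsupp f -> vle (term f a p) M.
    move=> pg; have [->|pm] := eqVneq p m0; first exact: veqW.
    by apply: vltW; exact: fM.
  have -> : peval f a = term f a m0 by exact: tsum_unique (fset_uniq _) m0f m0M fM.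
  have -> : term f a m0 = term F a m0 by rewrite /term FE.
  apply: (@tsum_unique _ _ _ _ _ M).
  + exact: fset_uniq.
  + by rewrite finsuppN0 FE -finsuppN0.
  + by rewrite /term FE.
  + move=> k kF km; have [[ek kE]|[b kb kE]] := full_closure_cases kF.
      by rewrite -/(mono a k) kE; apply: fM => //; exact: ek.1.
    rewrite -/(mono a k) -/(term F a k).
    have [ak|ak] := boolP (alive a k); last first.
      by move: (term_eq0 F a k); rewrite ak orbT => /eqP->.
    rewrite (ghost_val _ _ kb ak) /=; have [w kw] := hull_ghost _ _ kb.
    rewrite lt_neqAle (weights_le kw ak fM') andbT; apply/eqP => e.
    by rewrite (weights_unique kw ak fM' e fM) eqxx in km.
- have -> : peval f a = Gho M by exact: tsum_two (fset_uniq _) m1f m2f m12 m1M m2M fM.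
  have [m1F [v1 g1]] := attained_full_closure m1f m1M fM.
  have [m2F [v2 g2]] := attained_full_closure m2f m2M fM.
  exact: tsum_two (fset_uniq _) m1F m2F m12 v1 v2 (Fle _ fM).
Qed.

End FullClosure.

(** * Full polynomials and polynomial functions *)

Section Reduced.
Context {R : realType} {n : nat}.
Local Notation space := (@Defs.space R n).
Implicit Types (f g h : tpoly R n) (m p q k : expo n) (a : tpoint R n) (x : 'rV[R]_n).

(** Agreement at finite tangible points only; by [tan_eq_full_closure] it already determines the
    full closure. *)
Definition tan_eq f g := forall x, peval f (tanpt x) = peval g (tanpt x).

Lemma peval_tan_ge f x k : k \in finsupp f ->
  ~~ vlt (peval f (tanpt x)) (aff (graph_pt f k) x).
Proof.
move=> kf; have kM := tan_term x kf; apply/negP.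
have [f0|[m0 [M [m0f m0M fM]]]|[m1 [m2 [M [[m1f m2f m12] m1M m2M fM]]]]] :=
    tsum_cases (term f (tanpt x)) (fset_uniq (finsupp f)).
- by rewrite f0 in kM.
- have -> : peval f (tanpt x) = term f (tanpt x) m0.
    exact: tsum_unique (fset_uniq _) m0f m0M fM.
  have [e|/(fM k kf)] := eqVneq k m0; first by rewrite -e => /vlt_veqF; rewrite kM.
  by case: term kM => //= b /eqP->; case: term m0M => //= c /eqP-> lt /(lt_trans lt);
    rewrite ltxx.
- have -> : peval f (tanpt x) = Gho M.
    exact: tsum_two (fset_uniq _) m1f m2f m12 m1M m2M fM.
  have := fM k kf; case: term kM => //= b /eqP-> le lt;
  by have := le_lt_trans le lt; rewrite ltxx.
Qed.

Lemma tan_eq_le f g x k : tan_eq f g -> k \in finsupp f ->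
  exists2 k', k' \in finsupp g & aff (graph_pt f k) x <= aff (graph_pt g k') x.
Proof.
move=> fg kf; apply: contrapT => h; have := peval_tan_ge x kf; rewrite fg => /negP; apply.
apply: vlt_sum => p pg _; have : aff (graph_pt g p) x < aff (graph_pt f k) x.
  by rewrite ltNge; apply/negP => le; apply: h; exists p.
by rewrite -/(mono _ p) -/(term g _ p); have := tan_term x pg; case: term => //= b /eqP->.
Qed.

Lemma tan_eq_hull f g (v : space) : tan_eq f g -> newton_hull f v ->
  exists2 t, v.2 <= t & newton_hull g (v.1, t).
Proof.
move=> fg fv; apply: newton_above => x; have [k kf vk] := newton_le x fv.
have [k' k'g kk'] := tan_eq_le x fg kf.
by exists k' => //; exact: le_trans vk kk'.
Qed.

Lemma tan_eq_complex f g (v : space) : tan_eq f g ->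
  essential_complex f v -> essential_complex g v.
Proof.
move=> fg; have gf : tan_eq g f by move=> x.
case: v => v b [fv fmax].
have le t : newton_hull g (v, t) -> t <= b.
  by move=> /(tan_eq_hull gf)[t' /= tt' /fmax]; exact: le_trans.
split; last by move=> t /le.
have [t /= bt gt] := tan_eq_hull fg fv.
by have -> : b = t by apply/eqP; rewrite eq_le bt le.
Qed.

(** If a monomial k of g reaches at x the value c of m, the polytope of f has a point over k of
    value at least c there, and [weights_unique] forces k = m. So m alone attains the maximum of g,
    and equal values give equal coefficients. *)
Lemma tan_eq_dominant f g m x : tan_eq f g -> dominant f m x ->
  dominant g m x /\ g m = f m.
Proof.
move=> fg mx; have gf : tan_eq g f by move=> y.
have fm := tan_term x mx.1; have fE := peval_dominant mx.
set c := aff (graph_pt f m) x in fm.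
have fM p : p \in finsupp f -> vle (term f (tanpt x) p) c.
  move=> pf; have [->|pm] := eqVneq p m; first exact: veqW.
  by apply/vltW/(dominant_vlt mx).
have att k : k \in finsupp g -> veq (term g (tanpt x) k) c -> k = m.
  move=> kg kc; have [t /= tk fk] := tan_eq_hull gf (newton_mem kg).
  have [w kw] := hull_weightsP fk.
  apply: (weights_unique kw (alive_tan x k) fM _ (dominant_vlt mx)).
  apply/eqP; rewrite eq_le; apply/andP; split.
    by have := weights_le kw (alive_tan x k) fM.
  have : aff (graph_pt g k) x = c.
    by have := tan_term x kg; case: term kc => //= b /eqP-> /eqP.
  by rewrite coords_tan => <-; rewrite /aff lerD2r.
have [g0|[m0 [M [m0g m0M gM]]]|[m1 [m2 [M [[m1g m2g m12] m1M m2M gM]]]]] :=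
    tsum_cases (term g (tanpt x)) (fset_uniq (finsupp g)).
- have : peval g (tanpt x) = 0 by rewrite /peval big_seq big1// => k /g0.
  by rewrite -fg fE => e; rewrite e in fm.
- have gE : peval g (tanpt x) = term g (tanpt x) m0.
    exact: tsum_unique (fset_uniq _) m0g m0M gM.
  have m0c : veq (term g (tanpt x) m0) c by rewrite -gE -fg fE.
  have e := att _ m0g m0c; subst m0; split.
    split=> // k kg km; have := gM k kg km; have := tan_term x kg.
    have := tan_term x m0g; case: term m0M => //= b /eqP-> /eqP->;
    by case: term => //= d /eqP->.
  move: gE; rewrite -fg fE /term !mono_tan !tmulE.
  by case: (f m) (g m) => [|u|u] [|v|v]//= [/addIr->].
- have gE : peval g (tanpt x) = Gho M.
    exact: tsum_two (fset_uniq _) m1g m2g m12 m1M m2M gM.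
  move: fm; rewrite -fE fg gE /= => /eqP Mc; rewrite Mc in m1M m2M.
  by rewrite (att _ m1g m1M) (att _ m2g m2M) eqxx in m12.
Qed.

Lemma tan_eq_essential f g m : tan_eq f g -> essential f m ->
  essential g m /\ g m = f m.
Proof.
move=> fg /essential_dominant[x /(tan_eq_dominant fg)[mx ->]].
by split => //; exact: dominant_essential mx.
Qed.

Lemma tan_eq_nonvertex f g m (b : R) : tan_eq f g -> nonvertex_point f m b ->
  nonvertex_point g m b.
Proof.
move=> fg [cb nv]; split; first exact: tan_eq_complex cb.
move=> /vertex_essential /(@tan_eq_essential g f)[//|em _].
by apply: nv; exact: essential_vertex.
Qed.

Lemma tan_eq_full_closure f g : tan_eq f g -> full_closure f = full_closure g.
Proof.
move=> fg; have gf : tan_eq g f by move=> x.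
apply/fsfunP => m.
have [em|em] := pselect (essential f m).
  have [eg gm] := tan_eq_essential fg em.
  by rewrite !full_closure_essential.
have [[b mb]|mb] := pselect (exists b, nonvertex_point f m b).
  by rewrite (full_closure_ghost mb) (full_closure_ghost (tan_eq_nonvertex fg mb)).
rewrite !full_closure_eq0// => [/(tan_eq_essential gf)[]//|[b gb]].
by apply: mb; exists b; exact: tan_eq_nonvertex gb.
Qed.

Lemma full_full_closure f : full (full_closure f).
Proof. by apply: tan_eq_full_closure => x; rewrite peval_full_closure. Qed.

Lemma full_tan_eq f g : full f -> full g -> tan_eq f g -> f = g.
Proof. by move=> ff fg' fg; rewrite -ff -fg'; exact: tan_eq_full_closure. Qed.

Lemma peval_fadd f g a : peval (fadd f g) a = peval f a + peval g a.
Proof. by rewrite peval_full_closure peval_padd. Qed.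

Lemma peval_fmul f g a : peval (fmul f g) a = peval f a * peval g a.
Proof. by rewrite peval_full_closure peval_pmul. Qed.

Lemma peval_fexp f (k : nat) a : peval (fexp f k) a = peval f a ^+ k.
Proof.
case: k => [|k]; first by rewrite expr0 /fexp /= term_pmon mono0 mulr1.
elim: k => [|k IH]; first by rewrite expr1.
by rewrite exprS -IH -peval_fmul.
Qed.

Lemma full_fexp f (k : nat) : full f -> (0 < k)%N -> full (fexp f k).
Proof. by case: k => [|[|k]]// _ _; exact: full_full_closure. Qed.

(** Outside its essential monomials a full polynomial has only ghost coefficients. *)
Lemma full_tangible_dominant f m : full f -> tangible (f m) -> exists x, dominant f m x.
Proof.
move=> ff fm; have mf : m \in finsupp (full_closure f).
  by rewrite ff finsuppN0; case: (f m) fm.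
have [[em _]|[b _ fb]] := full_closure_cases mf; first exact: essential_dominant.
by rewrite -ff fb in fm.
Qed.

(** As a function this is the constant ghost of 0, and multiplication by it turns every value into
    its ghost. *)
Definition ghost_one : tpoly R n := full_closure (pmon 0 (Gho 0)).

Lemma full_ghost_one : full_ghost R n ghost_one.
Proof.
split; first exact: full_full_closure.
move=> m /full_closure_cases[[[mf _] ->]|[b _ ->]]; last by exists b.
by move: mf; rewrite finsuppN0 pmonE; case: ifP => [_ _|]; [exists 0|rewrite eqxx].
Qed.

Lemma peval_ghost_one a : peval ghost_one a = Gho 0.
Proof. by rewrite peval_full_closure term_pmon mono0 mulr1. Qed.

End Reduced.

(** * Connected components *)

Section Components.
Context {R : realType} {n : nat}.
Local Notation space := (@Defs.space R n).
Implicit Types (f g h : tpoly R n) (m p q k : expo n) (a : tpoint R n) (x : 'rV[R]_n).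

(** A closed set contains the ghost of each of its tangible elements; this is the complementary
    form. *)
Lemma trop_open_ghost (O : set (trop R)) (c : R) : open O -> O (Gho c) -> O (Tan c).
Proof.
move=> /trop_closedP[_ _ nuO] Oc; apply: contrapT => nOc; apply: (nuO (Gho c)) => //.
by exists (Tan c) => //; split => //; right; exists c.
Qed.

Lemma continuous_Tan : continuous (@Tan R).
Proof.
apply/continuousP => O /trop_closedP[[_ cO] _ _].
rewrite -[X in open X]setCK openC.
have -> : ~` (@Tan R @^-1` O) =
    expR @^-1` (half_line @` (nu @` (~` O `&` Rbar))).
  apply/seteqP; split => c /=.
    by move=> Oc; exists (Gho c) => //; exists (Tan c) => //; split => //; right; exists c.
  move=> [_ [y [Oy [->|[d yE]]] <-]]; first by move=> /= e; have := expR_gt0 c; rewrite -e ltxx.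
  by subst y => /= /expR_inj <-.
apply: closed_comp cO => c _; exact: continuous_expR.
Qed.

Lemma continuous_tanpt (T : topologicalType) (u : T -> 'rV[R]_n) :
  (forall i, continuous (fun t => u t 0 i)) -> continuous (tanpt \o u : T -> tpoint R n).
Proof.
move=> cu t; apply/cvg_sup => i U [V [[W oW <-]] Wt WU].
apply: (filterS WU); apply: (@continuous_comp _ _ _ (fun t => u t 0 i) (@Tan R)).
- exact: cu.
- exact: continuous_Tan.
- exact: open_nbhs_nbhs.
Qed.

(* This point is in the closure of tanpt x, and a polynomial whose dominant
   monomial at x is the tangible m stays tangible there. So g has to be tangible
   there too, which keeps its dominant monomial within the support of m. *)
Definition ghostpt x m : tpoint R n :=
  fun i => if m i == 0%N then Gho (x 0 i) else Tan (x 0 i).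

Lemma nbhs_ghostpt x m (B : set (tpoint R n)) :
  nbhs (ghostpt x m) B -> B (tanpt x).
Proof.
have : globally [set (tanpt x : tpoint R n)] --> (ghostpt x m : tpoint R n).
  apply/cvg_sup => i U [V [[W oW <-]] Wt WU] _ ->; apply: WU; move: Wt.
  by rewrite /= /ghostpt /tanpt; case: ifP => // _; exact: trop_open_ghost.
by move=> h /h; apply.
Qed.

(** Every neighbourhood of [ghostpt x m] contains [tanpt x], so no relatively clopen subset
    separates the two points. *)
Lemma connected_ghostpt x m : connected [set (tanpt x : tpoint R n); ghostpt x m].
Proof.
move=> B [y By] [C oC BC] [D cD BD].
have Bx : B (tanpt x).
  move: By; rewrite BC => -[[->|->] Cy]; first by split => //; left.
  by split; [left|apply: (@nbhs_ghostpt x m); apply: open_nbhs_nbhs].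
have Bg : B (ghostpt x m).
  rewrite BD; split; [by right|]; apply: contrapT => nD.
  have : (~` D) (tanpt x).
    by apply: (@nbhs_ghostpt x m); apply: open_nbhs_nbhs; split => //; exact: closed_openC.
  by apply; move: Bx; rewrite BD => -[].
by apply/seteqP; split => [|z [->|->]//]; rewrite BC; apply: subIsetl.
Qed.

Lemma dominant_convex f m x y (t : R) : 0 <= t <= 1 ->
  dominant f m x -> dominant f m y -> dominant f m ((1 - t) *: x + t *: y).
Proof.
move=> /andP[t0 t1] [mf mx] [_ my]; split => // k kf km.
rewrite !aff_convex; have := mx k kf km; have := my k kf km.
by move: t0; rewrite le_eqVlt => /orP[/eqP<-|]; nra.
Qed.

Lemma tangible_mono a m : tangible (mono a m) = [forall i, (m i == 0)%N || tangible (a i)].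
Proof.
apply/idP/forallP => [mt i|mt].
  by move: mt; rewrite /mono (bigD1 i)//= tangibleM tangibleX => /andP[].
rewrite /mono; elim/big_rec: _ => // i y _ yt.
by rewrite tangibleM tangibleX mt.
Qed.

Lemma coords_ghostpt x m : coords (ghostpt x m) = x.
Proof. by apply/rowP => i; rewrite mxE /ghostpt; case: ifP. Qed.

Lemma alive_ghostpt x m k : alive (ghostpt x m) k.
Proof. by apply/forallP => i; rewrite /ghostpt; case: ifP. Qed.

Lemma nonZtr f a : (~` Ztr f) a <-> tangible (peval f a).
Proof.
rewrite /Ztr /=; split => [h|t /Ubar_tangible/negP//].
by apply: contrapT => /negP ?; apply: h; exact/Ubar_tangible.
Qed.

Lemma tangible_dominant g a x :
  (forall k, k \in finsupp g -> alive a k) -> coords a = x -> tangible (peval g a) ->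
  exists q, dominant g q x /\ tangible (term g a q).
Proof.
move=> ag ax; case E : (peval g a) => [|c|] // _.
have [q [qg qc gc]] := tsum_tangible (fset_uniq _) E.
exists q; rewrite /term qc; split => //; split => // k kg kq.
have := alive_term qg (ag q qg); rewrite ax /term qc /= => /eqP <-.
have := alive_term kg (ag k kg); rewrite ax; have := gc k kg kq.
by rewrite -/(mono a k) -/(term g a k); case: term => //= b lt /eqP <-.
Qed.

Lemma dominant_uniq g p q x : dominant g p x -> dominant g q x -> p = q.
Proof.
move=> [pg px] [qg qx]; apply/eqP; apply: contrapT => /negP pq.
have := px q qg; rewrite eq_sym => /(_ pq).
by have := qx p pg pq => /lt_trans h /h; rewrite ltxx.
Qed.

Lemma peval_dominant_tangible g q x : tangible (g q) -> dominant g q x ->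
  tangible (peval g (tanpt x)).
Proof.
move=> gq /peval_dominant->; rewrite tangibleM gq mono_tan.
by [].
Qed.

(* If q dominates at x and p <> q at y, then at the first crossing time of q
   with another monomial along the segment two monomials are maximal. *)
Lemma dominant_segment g p q x y : dominant g q x -> dominant g p y ->
  (forall t : R, 0 <= t <= 1 -> exists k, dominant g k ((1 - t) *: x + t *: y)) ->
  p = q.
Proof.
move=> [qg qx] [pg py] h; apply/eqP; apply: contrapT => /negP pq.
pose d k z := aff (graph_pt g k) z - aff (graph_pt g q) z.
pose s := [seq k <- finsupp g | (k != q) && (0 <= d k y)].
(* For k in [s], [d k] is negative at x and nonnegative at y, and [T k] is the time at which k
   catches up with q. *)
pose T k := - d k x / (d k y - d k x).
have : s != [::].
  suff : p \in s by case: s.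
  by rewrite mem_filter pq pg andbT /= subr_ge0 ltW// py// eq_sym.
move=> /(seq_argmin T)[k]; rewrite mem_filter => /andP[/andP[kq dky] kg] kmin.
have dx i : i \in finsupp g -> i != q -> d i x < 0.
  by move=> ig iq; rewrite subr_lt0 qx.
have dkx := dx k kg kq; have D0 : 0 < d k y - d k x by lra.
have Tk : T k * (d k y - d k x) = - d k x by rewrite /T divfK// gt_eqF.
have T01 : 0 <= T k <= 1.
  by rewrite /T divr_ge0 ?ler_pdivrMr//=; lra.
have dE i : d i ((1 - T k) *: x + T k *: y) = (1 - T k) * d i x + T k * d i y.
  by rewrite /d !aff_convex; ring.
have [r [rg rz]] := h _ T01; set z := _ + _ in dE rz.
have dkz : d k z = 0 by rewrite dE; lra.
have le i : i \in finsupp g -> d i z <= 0.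
  move=> ig; have [->|iq] := eqVneq i q; first by rewrite /d subrr.
  have dix := dx i ig iq; rewrite dE; have [iy|iy] := leP 0 (d i y); last by nra.
  have /kmin Tki : i \in s by rewrite mem_filter iq iy.
  have Di : 0 < d i y - d i x by lra.
  have Ti : T i * (d i y - d i x) = - d i x by rewrite /T divfK// gt_eqF.
  by nra.
have := le r rg; rewrite /d subr_le0 => rq.
have [e|qr] := eqVneq q r; last by have := rz q qg qr; lra.
have := rz k kg; rewrite -e => /(_ kq); move: dkz; rewrite /d; lra.
Qed.

(** A segment of points where m dominates f lies in one component of f, hence in [D], where g is
    tangible; [dominant_segment] then yields a single q. The pair [tanpt x0], [ghostpt x0 m] is
    connected too, and tangibility of g at the second point excludes from q the variables absent
    from m. *)
Lemma Ctr_region f g m (c : R) (D : set (tpoint R n)) x0 :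
  f m = Tan c -> dominant f m x0 -> Ctr g D ->
  connected_component (~` Ztr f) (tanpt x0) `<=` D ->
  exists q, [/\ tangible (g q), forall i, m i = 0%N -> q i = 0%N &
    forall x, dominant f m x -> dominant g q x].
Proof.
move=> fm mx0 gD fD.
have tf x : dominant f m x -> (~` Ztr f) (tanpt x).
  by move=> mx; apply/nonZtr/(peval_dominant_tangible _ mx); rewrite fm.
have Dg : D `<=` ~` Ztr g.
  by case: gD => [[_ ->]//|[b _ ->]]; exact: connected_component_sub.
have tanD x : dominant f m x -> connected_component (~` Ztr f) (tanpt x0) (tanpt x).
  move=> mx; pose u (t : R) : 'rV[R]_n := (1 - t) *: x0 + t *: x.
  have cu i : continuous (fun t => u t 0 i).
    have -> : (fun t => u t 0 i) = (fun t => (1 - t) * x0 0 i + t * x 0 i).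
      by apply/funext => t; rewrite !mxE.
    move=> t; apply: cvgD; apply: cvgMl; last exact: cvg_id.
    by apply: cvgB; [exact: cvg_cst|exact: cvg_id].
  exists ((tanpt \o u : R -> tpoint R n) @` `[0, 1]%classic); last first.
    by exists 1 => /=; rewrite ?in_itv /= ?ler01 ?lexx// /u subrr scale0r add0r scale1r.
  split.
  - by exists 0 => /=; rewrite ?in_itv /= ?ler01 ?lexx// /u subr0 scale0r addr0 scale1r.
  - move=> _ [t + <-]; rewrite /= in_itv /= => t01; apply: tf; exact: dominant_convex.
  - apply: connected_continuous_connected; first exact: segment_connected.
    by apply: continuous_subspaceT; exact: continuous_tanpt.
have tang x : dominant f m x -> tangible (peval g (tanpt x)).
  by move=> /tanD/fD/Dg/nonZtr.
have dom x : dominant f m x -> exists q, dominant g q x /\ tangible (term g (tanpt x) q).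
  move=> /tang; apply: tangible_dominant; last exact: coords_tan.
  by move=> k _; exact: alive_tan.
have [q [qx0 gq]] := dom _ mx0.
have domq x : dominant f m x -> dominant g q x.
  move=> mx; have [p [px _]] := dom _ mx.
  suff <- : p = q by [].
  apply: dominant_segment qx0 px _ => t t01.
  have [k [kt _]] := dom _ (dominant_convex t01 mx0 mx).
  by exists k.
exists q; split => //; first by move: gq; rewrite tangibleM => /andP[].
move=> i mi.
have gD0 : connected_component (~` Ztr f) (tanpt x0) (ghostpt x0 m).
  exists [set (tanpt x0 : tpoint R n); ghostpt x0 m]; last by right.
  split; [by left| |exact: connected_ghostpt].
  move=> _ [->|->]; first exact: tf.
  apply/nonZtr; have -> : peval f (ghostpt x0 m) = term f (ghostpt x0 m) m.
    have [mf _] := mx0.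
    apply: (tsum_unique (fset_uniq _) mf (alive_term mf (alive_ghostpt x0 m m))) => k kf km.
    have := alive_term kf (alive_ghostpt x0 m k); rewrite !coords_ghostpt.
    have := mx0.2 k kf km.
    by rewrite -/(mono _ k) -/(term f _ k); case: term => //= b lt /eqP->.
  rewrite tangibleM fm tangible_mono /=; apply/forallP => j.
  by rewrite /ghostpt; case: ifP.
have [p [px pt]] : exists p, dominant g p x0 /\ tangible (term g (ghostpt x0 m) p).
  apply: tangible_dominant (coords_ghostpt x0 m) _.
    by move=> k _; exact: alive_ghostpt.
  by apply/nonZtr/Dg/fD.
move: pt; rewrite (dominant_uniq px qx0) tangibleM tangible_mono => /andP[_].
by move=> /forallP/(_ i); rewrite /ghostpt mi eqxx orbF => /eqP.
Qed.

End Components.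

(** * The Nullstellensatz *)

Section Nullstellensatz.
Context {R : realType} {n : nat}.
Local Notation space := (@Defs.space R n).
Implicit Types (f g h : tpoly R n) (m p q : expo n) (a : tpoint R n) (x : 'rV[R]_n).

Lemma Ztr_fexp f (k : nat) : (0 < k)%N -> Ztr (fexp f k) = Ztr f.
Proof.
move=> k0; apply/seteqP; split => a; rewrite /Ztr /= peval_fexp => /Ubar_tangible fa;
  by apply/Ubar_tangible; move: fa; rewrite tangibleX eqn0Ngt k0.
Qed.

(* A quantitative form of Farkas' lemma: an affine inequality valid where m
   dominates f costs at most a multiple of the defect of m elsewhere. *)
Lemma dominant_farkas f m x0 (u v : space) : dominant f m x0 ->
  (forall x, dominant f m x -> aff u x < aff v x) ->
  exists2 r : R, 0 <= r & forall x M,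
    (forall i, i \in finsupp f -> aff (graph_pt f i) x <= M) ->
    aff u x - aff v x <= r * (M - aff (graph_pt f m) x).
Proof.
move=> mx0 uv.
(* The elements of [K] are bounded by a combination of the defect of m and of v - u, with weights r
   and s. The clause for [s = 0] is there to exclude this case for the constant form. *)
pose K : set space := [set w | exists r s : R, [/\ 0 <= r, 0 <= s,
  s = 0 -> aff w x0 < 0 &
  forall x M, (forall i, i \in finsupp f -> aff (graph_pt f i) x <= M) ->
    aff w x <= r * (M - aff (graph_pt f m) x) + s * (aff v x - aff u x)]].
pose F := [seq graph_pt f i - graph_pt f m | i <- finsupp f & i != m].
have [||w|x|b b0 [r [s [r0 s0 sN h]]]] := @farkas _ _ K _ _ (v - u :: F).
- move=> w w' [r [s [r0 s0 sN h]]] [r' [s' [r0' s0' sN' h']]].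
  exists (r + r'), (s + s'); split; rewrite ?addr_ge0//.
    move=> /eqP; rewrite paddr_eq0// => /andP[/eqP/sN ? /eqP/sN' ?].
    by rewrite affD; lra.
  by move=> x M xM; rewrite affD; have := h x M xM; have := h' x M xM; lra.
- move=> e w e0 [r [s [r0 s0 sN h]]].
  exists (e * r), (e * s); split; rewrite ?mulr_ge0 ?(ltW e0)//.
    by move=> /eqP; rewrite mulf_eq0 gt_eqF//= => /eqP/sN ?; rewrite affZ pmulr_rlt0.
  by move=> x M xM; rewrite affZ -!mulrA -mulrDr ler_pM2l// h.
- rewrite inE => /orP[/eqP->|/mapP[i]].
    exists 0, 1; split => //; first by move/eqP; rewrite oner_eq0.
    by move=> x M _; rewrite mul0r add0r mul1r affB.
  rewrite mem_filter => /andP[im iF] ->; exists 1, 0; split => //.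
    by move=> _; rewrite affB subr_lt0 mx0.2.
  by move=> x M xM; rewrite mul1r mul0r addr0 affB lerD2r xM.
(* If all forms of the list were negative at x, m would dominate f there, and [uv] would make v - u
   positive. *)
- apply: contrapT => h.
  have h' w : w \in v - u :: F -> aff w x < 0.
    by move=> wF; rewrite ltNge; apply/negP => w0; apply: h; exists w.
  have := h' _ (mem_head _ _); rewrite affB; suff /uv : dominant f m x by lra.
  split=> [|i iF im]; first exact: mx0.1.
  rewrite -subr_lt0 -affB h'// inE; apply/orP; right; apply/mapP.
  by exists i => //; rewrite mem_filter im.
have affb x : aff (0, b) x = b.
  by rewrite /aff /= big1 ?addr0// => i _; rewrite mxE mul0r.
(* The constant form b >= 0 is not negative at [x0], so s is positive and can be divided out. *)
have sp : 0 < s.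
  rewrite lt_def s0 andbT; apply/eqP => /sN; rewrite affb; lra.
exists (r / s) => [|x M xM]; first by rewrite divr_ge0.
have := h x M xM; rewrite affb mulrAC ler_pdivlMr//; lra.
Qed.

Lemma dominant_farkas_poly f m x0 g q : dominant f m x0 ->
  (forall x, dominant f m x -> dominant g q x) ->
  exists2 r : R, 0 <= r & forall x M,
    (forall i, i \in finsupp f -> aff (graph_pt f i) x <= M) ->
    vle (peval g (tanpt x)) (aff (graph_pt g q) x + r * (M - aff (graph_pt f m) x)).
Proof.
move=> mx0 fg.
have [|p pg|r hr] := @seq_uniform R _ (finsupp g) (fun p r => 0 <= r /\ forall x M,
    (forall i, i \in finsupp f -> aff (graph_pt f i) x <= M) ->
    aff (graph_pt g p) x - aff (graph_pt g q) x <= r * (M - aff (graph_pt f m) x)).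
- move=> p r r' rr' [r0 h]; split; first exact: le_trans rr'.
  move=> x M xM; apply: le_trans (h x M xM) _; rewrite ler_wpM2r// subr_ge0 xM//.
  exact: mx0.1.
- have [->|pq] := eqVneq p q.
    by exists 0; split => // x M _; rewrite mul0r subrr.
  have [r r0 h] := dominant_farkas mx0 (fun x mx => (fg x mx).2 p pg pq).
  by exists r.
have [r0 _] := hr q (fg x0 mx0).1.
exists r => // x M xM; apply: vle_sum => p pg _; have [_ /(_ x M xM)] := hr p pg.
by have := tan_term x pg; rewrite /term /mono; case: (_ * _) => //= b /eqP->; lra.
Qed.

(** * Functions realized by the ideal *)

Section Ideal.
Variable A : set (tpoly R n).
Hypothesis idA : tropical_ideal A.

Definition polyfun (u : 'rV[R]_n -> trop R) :=
  exists h, forall x, peval h (tanpt x) = u x.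

(** The ideal is handled through functions on R^n, so that full closures need not be followed
    through sums and products; [full_tan_eq] turns the final equality of functions into one of
    polynomials. *)
Definition realized (u : 'rV[R]_n -> trop R) :=
  exists2 g, A g & forall x, peval g (tanpt x) = u x.

Lemma polyfun_mono (c : trop R) m : polyfun (fun x => c * mono (tanpt x) m).
Proof. by exists (pmon m c) => x; rewrite term_pmon. Qed.

Lemma polyfunM u v : polyfun u -> polyfun v -> polyfun (fun x => u x * v x).
Proof. by move=> [f fu] [g gv]; exists (pmul f g) => x; rewrite peval_pmul fu gv. Qed.

Lemma polyfunD u v : polyfun u -> polyfun v -> polyfun (fun x => u x + v x).
Proof. by move=> [f fu] [g gv]; exists (padd f g) => x; rewrite peval_padd fu gv. Qed.

Lemma polyfunX u (k : nat) : polyfun u -> polyfun (fun x => u x ^+ k).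
Proof. by move=> [f fu]; exists (fexp f k) => x; rewrite peval_fexp fu. Qed.

Lemma polyfun_sum (T : Type) (s : seq T) (P : pred T) (u : T -> 'rV[R]_n -> trop R) :
  (forall i, polyfun (u i)) -> polyfun (fun x => \sum_(i <- s | P i) u i x).
Proof.
move=> pu; elim: s => [|i s [f fu]].
  by exists pzero => x; rewrite peval_pzero big_nil.
have [g gu] := pu i; exists (if P i then padd g f else f) => x.
by rewrite big_cons; case: ifP; rewrite ?peval_padd fu ?gu.
Qed.

Lemma realized0 : realized (fun=> 0).
Proof. by have [_ A0 _ _] := idA; exists pzero => // x; rewrite peval_pzero. Qed.

Lemma realizedD u v : realized u -> realized v -> realized (fun x => u x + v x).
Proof.
have [_ _ AD _] := idA; move=> [f Af fu] [g Ag gv].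
by exists (fadd f g); [exact: AD|move=> x; rewrite peval_fadd fu gv].
Qed.

Lemma realizedM u v : polyfun u -> realized v -> realized (fun x => u x * v x).
Proof.
have [_ _ _ AM] := idA; move=> [f fu] [g Ag gv].
exists (fmul (full_closure f) g); first by apply: AM => //; exact: full_full_closure.
by move=> x; rewrite peval_fmul peval_full_closure fu gv.
Qed.

Lemma realized_ghost u : full_ghost R n `<=` A -> polyfun u ->
  realized (fun x => Gho 0 * u x).
Proof.
move=> gA pu; have [|g Ag gu] := @realizedM u (fun=> Gho 0) pu.
  by exists ghost_one; [apply/gA/full_ghost_one|move=> x; rewrite peval_ghost_one].
by exists g => // x; rewrite gu mulrC.
Qed.

(* M plays the role of the value of f at x, and M *+ k of the value of its k-th
   power. *)
Definition local_power f m (k : nat) (u : 'rV[R]_n -> trop R) :=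
  (forall x M, (forall i, i \in finsupp f -> aff (graph_pt f i) x <= M) ->
     vle (u x) (M *+ k) /\ (aff (graph_pt f m) x < M -> vlt (u x) (M *+ k))) /\
  (forall x, dominant f m x -> u x = term f (tanpt x) m ^+ k).

(** The product of g with the monomial of exponent k m - q and coefficient [c *+ k - d] has the k-th
    power of m in place of q; [dominant_farkas_poly] controls the other monomials. *)
Lemma exists_local_power f m (c : R) g q x0 :
  f m = Tan c -> dominant f m x0 -> A g -> tangible (g q) ->
  (forall i, m i = 0%N -> q i = 0%N) ->
  (forall x, dominant f m x -> dominant g q x) ->
  exists r : R, forall k : nat, r <= k%:R ->
    exists2 u, realized u & local_power f m k u.
Proof.
move=> fm mx0 Ag gq supp fg; case gqE : (g q) gq => [|d|] // _.
have [r r0 gr] := dominant_farkas_poly mx0 fg.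
(* The summand 1 makes r < k strict. The sum of the exponents of q makes k m - q nonnegative in the
   variables of m; the other variables are absent from q. *)
exists (r + 1 + (\sum_i q i)%:R) => k rk.
have rk' : r < k%:R by have := ler0n R (\sum_i q i)%N; lra.
have qk i : (q i <= k * m i)%N.
  have [mi|mi] := posnP (m i); first by rewrite supp.
  have : (\sum_i q i <= k)%N by rewrite -(ler_nat R); lra.
  rewrite (bigD1 i)//= => h; rewrite (leq_trans (leq_trans (leq_addr _ _) h))//.
  by rewrite leq_pmulr.
pose e : expo n := [ffun i => (k * m i - q i)%N].
have eE x : \sum_i expv e 0 i * x 0 i =
    k%:R * (\sum_i expv m 0 i * x 0 i) - \sum_i expv q 0 i * x 0 i.
  rewrite mulr_sumr -sumrB; apply: eq_bigr => i _.
  by rewrite !mxE ffunE natrB// natrM; ring.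
pose b x := Tan (c *+ k - d) * mono (tanpt x) e.
have bE x : b x = Tan (k%:R * aff (graph_pt f m) x - aff (graph_pt g q) x).
  rewrite /b mono_tan eE tmulE /aff /graph_pt fm gqE /= -mulr_natl; congr Tan; ring.
exists (fun x => b x * peval g (tanpt x)).
  by apply: realizedM; [exact: polyfun_mono|exists g].
split=> [x M xM|x mx].
  have mM : aff (graph_pt f m) x <= M by apply: xM; exact: mx0.1.
  have vb : veq (b x) (k%:R * aff (graph_pt f m) x - aff (graph_pt g q) x).
    by rewrite bE /=.
  (* With v the value of m at x, this bound is k v + r (M - v) = k M - (k - r) (M - v). *)
  have bg := vleM (veqW vb) (gr x M xM).
  rewrite -mulr_natl; split.
    apply: vle_trans bg.
    have : 0 <= (k%:R - r) * (M - aff (graph_pt f m) x) by rewrite mulr_ge0 ?subr_ge0// ltW.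
    lra.
  move=> mM'; apply: vle_lt_trans bg.
  have : 0 < (k%:R - r) * (M - aff (graph_pt f m) x) by rewrite mulr_gt0 ?subr_gt0.
  lra.
rewrite (peval_dominant (fg x mx)) /term gqE fm bE !mono_tan !tmulE /= TanX.
congr Tan; rewrite /aff /graph_pt fm gqE /= -mulr_natl; ring.
Qed.

(** Induction on [s]: where p dominates, the local powers of the other monomials are strictly below
    the k-th power of p and do not alter the sum. The last clause supplies this strict bound for the
    partial sum when a new monomial is added. *)
Lemma exists_power_sum f (k : nat) (s : seq (expo n)) : uniq s ->
  {subset s <= finsupp f} ->
  (forall m, m \in s -> exists2 u, realized u & local_power f m k u) ->
  exists2 u, realized u &
  [/\ forall x M, (forall i, i \in finsupp f -> aff (graph_pt f i) x <= M) ->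
        vle (u x) (M *+ k),
      forall x m, dominant f m x -> m \in s -> u x = term f (tanpt x) m ^+ k &
      forall x m, dominant f m x -> m \notin s ->
        vlt (u x) (aff (graph_pt f m) x *+ k)].
Proof.
elim: s => [|m s IH] /= => [_ _ _|/andP[ms us] sf h].
  by exists (fun=> 0); [exact: realized0|].
have [||v rv [vle_v veq_v vlt_v]] := IH us.
- by move=> i si; apply: sf; rewrite inE si orbT.
- by move=> i si; apply: h; rewrite inE si orbT.
have [u ru [u_le u_eq]] := h m (mem_head _ _).
have mf : m \in finsupp f by apply: sf; exact: mem_head.
have dom_le x p : dominant f p x ->
    forall i, i \in finsupp f -> aff (graph_pt f i) x <= aff (graph_pt f p) x.
  by move=> [_ px] i fi; have [->//|ip] := eqVneq i p; rewrite ltW// px.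
have u_lt x p : dominant f p x -> p != m -> vlt (u x) (aff (graph_pt f p) x *+ k).
  move=> px pm; have [_] := u_le x _ (dom_le x p px); apply.
  by apply: px.2 => //; rewrite eq_sym.
exists (fun x => u x + v x); first exact: realizedD.
split=> [x M xM|x p px|x p px].
- by rewrite vleD ?vle_v//; have [] := u_le x M xM.
- have tp : veq (term f (tanpt x) p ^+ k) (aff (graph_pt f p) x *+ k).
    by apply/veqX/tan_term; exact: px.1.
  rewrite inE => /orP[/eqP e|ps].
    by subst p; rewrite u_eq// (addr_vlt tp)// vlt_v.
  rewrite (veq_v x p)// addrC (addr_vlt tp)// u_lt//.
  by apply: contraNneq ms => <-.
- by rewrite inE negb_or => /andP[pm ps]; rewrite vltD ?u_lt ?vlt_v.
Qed.

(* For k > 0 this reaches the value of f^(k+1) exactly where f is ghost: either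
   two monomials are maximal there, or a ghost one is. *)
Definition ghost_power f (k : nat) x : trop R :=
  \sum_(m <- finsupp f) \sum_(p <- finsupp f | p != m)
     term f (tanpt x) m ^+ k * term f (tanpt x) p +
  \sum_(m <- finsupp f | ~~ tangible (f m)) term f (tanpt x) m ^+ k.+1.

Lemma polyfun_ghost_power f k : polyfun (ghost_power f k).
Proof.
have pt m : polyfun (fun x => term f (tanpt x) m) by exact: polyfun_mono.
apply: polyfunD; apply: polyfun_sum => m.
  apply: polyfun_sum => p; apply: polyfunM => //; exact: polyfunX.
exact: polyfunX.
Qed.

(** Each summand has a factor from a monomial other than m, strictly smaller at x. The positive
    exponent [k.+1] matters: with exponent 0 the first factor would disappear, and the second may be
    that of m. *)
Lemma ghost_power_lt f k x m : dominant f m x -> tangible (f m) ->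
  vlt (ghost_power f k.+1 x) (aff (graph_pt f m) x *+ k.+2).
Proof.
move=> mx tm; have lt := dominant_vlt mx.
have le i : i \in finsupp f -> vle (term f (tanpt x) i) (aff (graph_pt f m) x).
  move=> fi; have [->|im] := eqVneq i m; last by apply/vltW/lt.
  by apply/veqW/tan_term; exact: mx.1.
apply: vltD; apply: vlt_sum => p pf; last first.
  by move=> tp; apply/vltX/lt => //; apply: contraNneq tp => ->.
move=> _; apply: vlt_sum => q qf qp; rewrite mulrSr.
have [e|pm] := eqVneq p m; last by apply: vltM; [exact/vltX/lt|exact: le].
rewrite addrC mulrC; apply: vltM; last by apply/vleX/le.
by apply: lt; rewrite // -e.
Qed.

Lemma radical_of_Itr f : full_ghost R n `<=` A -> Itr (Ctr_ideal A) f ->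
  exists2 k : nat, (0 < k)%N & A (fexp f k).
Proof.
move=> gA [ff If].
(* The zero polynomial is vacuously a ghost polynomial, so its first power lies in [A]. *)
have [f0|fN0] := eqVneq (finsupp f) fset0.
  by exists 1%N => //; apply: gA; split => // m; rewrite f0.
(* One threshold [r] for the exponent serves all tangible monomials. *)
have [|m|r hr] := @seq_uniform R _ [seq m <- finsupp f | tangible (f m)]
  (fun m r => forall k : nat, r <= k%:R -> exists2 u, realized u & local_power f m k u).
- by move=> m r r' rr' h k r'k; apply: h; exact: le_trans r'k.
- rewrite mem_filter => /andP[tm mf]; have [x0 mx0] := full_tangible_dominant ff tm.
  case fm : (f m) tm => [|c|] // _.
  have [|D [g Ag gD] fD] := If (connected_component (~` Ztr f) (tanpt x0)).
    right; exists (tanpt x0) => //; apply/nonZtr.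
    by apply: (peval_dominant_tangible _ mx0); rewrite fm.
  have [q [gq supp fg]] := Ctr_region fm mx0 gD fD.
  exact: exists_local_power fm mx0 Ag gq supp fg.
(* The exponent [k.+2] is at least [r], and also at least 2, as [ghost_power_lt] requires. *)
pose k := (Num.bound `|r|).
have rk : r <= k.+2%:R.
  apply: le_trans (ler_norm r) _; apply: ltW; apply: lt_trans (archi_boundP (normr_ge0 r)) _.
  by rewrite ltr_nat.
have [|||u ru [u_le u_eq u_lt]] :=
    @exists_power_sum f k.+2 [seq m <- finsupp f | tangible (f m)].
- by rewrite filter_uniq ?fset_uniq.
- by move=> m; rewrite mem_filter => /andP[].
- by move=> m /hr; apply.
exists k.+2 => //.
(* [u] supplies the power where f is tangible, and the ghost of [ghost_power] supplies it where f is
   ghost. *)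
have [G AG Gu] := realizedD (realized_ghost gA (polyfun_ghost_power f k.+1)) ru.
suff <- : G = fexp f k.+2 by [].
have [sub _ _ _] := idA.
apply: full_tan_eq; [exact: sub|exact: full_fexp|] => x.
rewrite Gu peval_fexp.
have bound M : (forall i, i \in finsupp f -> vle (term f (tanpt x) i) M) ->
    vle (u x) (M *+ k.+2).
  move=> fM; apply: u_le => i fi; have := fM i fi.
  by have := tan_term x fi; case: term => //= b /eqP->.
have [t0|[m [M [mf mM fM]]]|[m1 [m2 [M [[m1f m2f m12] m1M m2M fM]]]]] :=
    tsum_cases (term f (tanpt x)) (fset_uniq (finsupp f)).
- have /fset0Pn[m mf] := fN0; have := tan_term x mf; by rewrite t0.
- have fM' i : i \in finsupp f -> vle (term f (tanpt x) i) M.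
    by move=> fi; have [->|im] := eqVneq i m; [exact: veqW|exact/vltW/fM].
  have -> : peval f (tanpt x) = term f (tanpt x) m.
    exact: tsum_unique (fset_uniq _) mf mM fM.
  have ME : M = aff (graph_pt f m) x.
    by have := tan_term x mf; case: term mM => //= b /eqP-> /eqP.
  have mx : dominant f m x.
    split => // i fi im; have := fM i fi im; rewrite -ME.
    by have := tan_term x fi; case: term => //= b /eqP->.
  (* For a tangible single maximum [u] is exact and the ghost part is strictly smaller; for a ghost
     one the summand of m in the second sum of [ghost_power] attains the value. *)
  have [tm|tm] := boolP (tangible (f m)).
    rewrite (u_eq x m mx); last by rewrite mem_filter tm.
    rewrite addrC; apply: (addr_vlt (veqX k.+2 mM)).
    have := ghost_power_lt k mx tm; rewrite -ME tmulE.
    by case: ghost_power => //= b; rewrite add0r.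
  have gM : veq (ghost_power f k.+1 x) (M *+ k.+2).
    rewrite /ghost_power addrC; apply: veqDl.
      apply: (@veq_sum _ _ _ _ _ m) => //; first exact: veqX.
      by move=> i fi _; apply/vleX/fM'.
    apply: vle_sum => i fi _; apply: vle_sum => j fj _.
    by rewrite mulrSr; apply: vleM; [apply/vleX|]; exact: fM'.
  rewrite (ghost_mul gM) addr_gho ?bound//; apply/esym/ghostP; first exact: veqX.
  by rewrite tangibleX /term tangibleM negb_and tm.
- have -> : peval f (tanpt x) = Gho M.
    exact: tsum_two (fset_uniq _) m1f m2f m12 m1M m2M fM.
  (* With two maxima, the product of [m1] to the power [k.+1] and [m2] attains the value. *)
  have gM : veq (ghost_power f k.+1 x) (M *+ k.+2).
    apply: veqDl; last by apply: vle_sum => i fi _; apply/vleX/fM.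
    have le i : i \in finsupp f -> vle (\sum_(p <- finsupp f | p != i)
        term f (tanpt x) i ^+ k.+1 * term f (tanpt x) p) (M *+ k.+2).
      move=> fi; apply: vle_sum => j fj _.
      by rewrite mulrSr; apply: vleM; [apply/vleX|]; exact: fM.
    apply: (@veq_sum _ _ _ _ _ m1) => // [|i fi _]; last exact: le.
    have m21 : m2 != m1 by rewrite eq_sym.
    rewrite mulrSr; apply: (@veq_sum _ _ _ _ _ m2) => //.
      by apply: veqM => //; exact: veqX.
    by move=> j fj _; apply: vleM; [apply/vleX|]; exact: fM.
  by rewrite (ghost_mul gM) addr_gho ?bound// GhoX.
Qed.

End Ideal.
End Nullstellensatz.

Theorem theorem5p7 (R : realType) (n : nat) (A : set (tpoly R n)) :
  tropical_ideal A -> finitely_generated A -> full_ghost R n `<=` A ->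
  radical A = Itr (Ctr_ideal A).
Proof.
move=> idA _ gA; apply/seteqP; split=> f; last first.
  move=> If; split; first by case: If.
  by have [k k0 Ak] := radical_of_Itr idA gA If; exists k.
(* f and its power are ghost at the same points, so each component of f is one of the ideal. *)
move=> [ff [k [k0 Ak]]]; split => // D fD; exists D => //.
by exists (fexp f k) => //; rewrite /Ctr Ztr_fexp.
Qed.
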